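(* Let $\Gamma\curvearrowright\Omega$ be a totally disconnected dynamical system. Assume that $E,E_1,E_2,\dots$ are $\Gamma$-semilattices and that $$\cdots\to\mathbb Z_0[E_2]\to\mathbb Z_0[E_1]\to\mathbb Z_0[E]\to C_0(\Omega,\mathbb Z)\to 0$$ is an algebraic independent resolution. Then $$\cdots\to C^*_u(E_2)\to C^*_u(E_1)\to C^*_u(E)\to C_0(\Omega)\to 0$$ is an independent resolution, where the homomorphisms in this sequence are induced by the ones from the algebraic independent resolution.
   Context: Groups are discrete and countable; spaces are second countable, locally compact and Hausdorff. A totally disconnected dynamical system $\Gamma\curvearrowright\Omega$ is a group $\Gamma$ acting by homeomorphisms on a totally disconnected space $\Omega$. A semilattice is a commutative semigroup in which every element is idempotent; all semilattices have a zero element $0$. A $\Gamma$-semilattice is a semilattice with an action of $\Gamma$ by semigroup automorphisms. $\mathbb Z_0[E]:=\mathbb Z[E]/\mathbb Z\cdot 0$ is the semigroup ring with the zero of $E$ identified with $0$. $C^*_u(E)$ is the universal C*-algebra generated by projections $p_e$, $e\in E$, with $p_0=0$ and $p_{de}=p_dp_e$; $\mathbb Z_0[E]$ is identified with the $\mathbb Z$-span of the $p_e$ in $C^*_u(E)$. $C_0(\Omega,\mathbb Z)$ is the ring of continuous $\mathbb Z$-valued functions on $\Omega$ vanishing at infinity. Actions of $\Gamma$ on $E$, $\Omega$ induce actions on $\mathbb Z_0[E]$, $C^*_u(E)$, $C_0(\Omega,\mathbb Z)$, $C_0(\Omega)$. An algebraic independent resolution is a $\Gamma$-equivariant long exact sequence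 of ring homomorphisms of the first displayed form. An independent resolution of $\Gamma\curvearrowright C_0(\Omega)$ is a $\Gamma$-equivariant long exact sequence of $*$-homomorphisms of the second displayed form. A ring homomorphism $\mathbb Z_0[E_k]\to\mathbb Z_0[E_{k-1}]$ (with $E_0=E$), respectively $\mathbb Z_0[E]\to C_0(\Omega,\mathbb Z)$, maps elements of the semilattice to projections of $C^*_u(E_{k-1})$, respectively $C_0(\Omega)$, and hence by universality induces a $*$-homomorphism on $C^*_u(E_k)$, respectively $C^*_u(E)$. *)

(* Defs.v *)
From HB Require Import structures.
From mathcomp Require Import all_boot all_order all_algebra.
From mathcomp Require Import complex freeg.
From mathcomp Require Import all_classical reals topology normedtype.

Set Implicit Arguments.
Unset Strict Implicit.
Unset Printing Implicit Defensive.

Import Order.TTheory GRing.Theory Num.Theory.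
Import numFieldNormedType.Exports.
Local Open Scope classical_set_scope.
Local Open Scope ring_scope.
Local Open Scope quotient_scope.

(* C*-algebras such as C_0(T) are non-unital, so the rings below are
   non-unital: the product is the semigroup law, written (x * y)%g.          *)

HB.mixin Record Semigroup_isSemilattice E of Semigroup E := {
  slzero : E;
  mulsC : forall x y : E, (x * y = y * x)%g;
  mulss : forall x : E, (x * x = x)%g;
  mul0s : forall x : E, (slzero * x = slzero)%g }.
#[short(type="semilatticeType")]
HB.structure Definition Semilattice :=
  {E of Semigroup_isSemilattice E & Semigroup E}.

HB.mixin Record Zmodule_isRng A of GRing.Zmodule A & Semigroup A := {
  rngDl : forall x y z : A, ((x + y)%R * z)%g = (x * z)%g + (y * z)%g;
  rngDr : forall x y z : A, (x * (y + z)%R)%g = (x * y)%g + (x * z)%g }.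
#[short(type="rngType")]
HB.structure Definition Rng :=
  {A of Zmodule_isRng A & GRing.Zmodule A & Semigroup A}.

HB.structure Definition RngHom (A B : rngType) :=
  {f of GRing.isZmodMorphism A B f & isMultiplicative A B f}.
Notation "{ 'rng' A -> B }" := (RngHom.type A B)
  (at level 0, A at level 98, B at level 99,
   format "{ 'rng'  A  ->  B }") : type_scope.

Section FreegInt.
Variable K : choiceType.
Implicit Types (D : {freeg K / int}).

Lemma freeg_int_ind (P : {freeg K / int} -> Prop) :
  (forall x, P << x >>) -> (forall D1 D2, P D1 -> P D2 -> P (D1 - D2)) ->
  P 0 -> forall D, P D.
Proof.
move=> PU PB P0; have PN D : P D -> P (- D) by rewrite -sub0r; exact: PB.
have PD D1 D2 : P D1 -> P D2 -> P (D1 + D2).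
  by move=> P1 P2; rewrite -[D2]opprK; apply/PB/PN.
have PMn D n : P D -> P (D *+ n).
  by move=> PD1; elim: n => [|n IHn]; rewrite ?mulr0n // mulrS; exact: PD.
move=> D; rewrite -(freeg_sumE D); apply: big_ind => // x _.
rewrite -[coeff x D]intz -freegU_mulz; case: (coeff x D) => n.
  by rewrite -pmulrn; exact: PMn.
by rewrite NegzE mulrNz -pmulrn; exact/PN/PMn.
Qed.

Variable M : lmodType int.

HB.instance Definition _ (f : K -> M) := GRing.isZmodMorphism.Build
  {freeg K / int} M (fglift f) (@lift_is_additive int K M f).

Lemma fglift1 (f : K -> M) x : fglift f << x >> = f x.
Proof. by rewrite liftU scale1r. Qed.

Lemma eq_fglift (f g : K -> M) : f =1 g -> fglift f =1 fglift g.
Proof.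
move=> fg; apply: freeg_int_ind => [x|D1 D2|]; rewrite ?fglift1 ?raddf0 //.
by rewrite !raddfB /= => -> ->.
Qed.
End FreegInt.

Section Z0.
Variable E : semilatticeType.
Local Notation ZE := {freeg E / int}.
Implicit Types (D : ZE) (d e : E).

(* The product of Z[E]: the bilinear extension of the product of E. *)
Definition ZE_mul D1 D2 : ZE :=
  fglift (fun d => fglift (fun e => << (d * e)%g >> : ZE) D2) D1.

Lemma ZE_mulU d e : ZE_mul << d >> << e >> = << (d * e)%g >>.
Proof. by rewrite /ZE_mul !fglift1. Qed.

Lemma ZE_mul0l D : ZE_mul 0 D = 0. Proof. exact: raddf0. Qed.

Lemma ZE_mulBl D1 D2 D : ZE_mul (D1 - D2) D = ZE_mul D1 D - ZE_mul D2 D.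
Proof. exact: raddfB. Qed.

Lemma ZE_mulBr D D1 D2 : ZE_mul D (D1 - D2) = ZE_mul D D1 - ZE_mul D D2.
Proof.
elim/freeg_int_ind: D => [d|D D' IHD IHD'|].
- by rewrite /ZE_mul !fglift1 raddfB.
- by rewrite !ZE_mulBl IHD IHD' !opprD !opprK addrACA.
- by rewrite !ZE_mul0l subrr.
Qed.

Lemma ZE_mul0r D : ZE_mul D 0 = 0.
Proof. by rewrite -[X in ZE_mul _ X](subrr 0) ZE_mulBr subrr. Qed.

Lemma ZE_mulA : associative ZE_mul.
Proof.
move=> D1 D2 D3; elim/freeg_int_ind: D1 => [d|D D' IHD IHD'|]; last 2 first.
- by rewrite !ZE_mulBl IHD IHD'.
- by rewrite !ZE_mul0l.
elim/freeg_int_ind: D2 => [e|D D' IHD IHD'|]; last 2 first.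
- by rewrite ZE_mulBl !ZE_mulBr ZE_mulBl IHD IHD'.
- by rewrite ZE_mul0l ZE_mul0r ZE_mul0l.
elim/freeg_int_ind: D3 => [f|D D' IHD IHD'|]; last 2 first.
- by rewrite !ZE_mulBr IHD IHD'.
- by rewrite !ZE_mul0r.
by rewrite !ZE_mulU mulgA.
Qed.

(* The ideal Z.0 of Z[E], where 0 is the zero of E (not that of Z[E]). *)
Definition ZE_zero_ideal : {pred ZE} :=
  fun D => `[< exists n : int, D = << n *g slzero >> >].

Fact ZE_zero_ideal_zmod_closed : zmod_closed ZE_zero_ideal.
Proof.
split=> [|D1 D2]; first by apply/asboolP; exists 0; rewrite freegU0.
move=> /asboolP[m ->] /asboolP[n ->]; apply/asboolP; exists (m - n).
by rewrite freegUB.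
Qed.
HB.instance Definition _ :=
  GRing.isZmodClosed.Build ZE ZE_zero_ideal ZE_zero_ideal_zmod_closed.

Lemma ZE_zero_idealMl D D' : D \in ZE_zero_ideal -> ZE_mul D' D \in ZE_zero_ideal.
Proof.
move=> /asboolP[n ->]; elim/freeg_int_ind: D' => [d|D1 D2 ID1 ID2|].
- apply/asboolP; exists n.
  by rewrite /ZE_mul fglift1 liftU mulsC mul0s -[n]intz scaler_int freegU_mulz.
- by rewrite ZE_mulBl rpredB.
- by rewrite ZE_mul0l rpred0.
Qed.

Lemma ZE_mulC : commutative ZE_mul.
Proof.
move=> D1 D2; elim/freeg_int_ind: D1 => [d|D D' IHD IHD'|]; last 2 first.
- by rewrite ZE_mulBl ZE_mulBr IHD IHD'.
- by rewrite ZE_mul0l ZE_mul0r.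
elim/freeg_int_ind: D2 => [e|D D' IHD IHD'|]; last 2 first.
- by rewrite ZE_mulBl ZE_mulBr IHD IHD'.
- by rewrite ZE_mul0l ZE_mul0r.
by rewrite !ZE_mulU mulsC.
Qed.

Definition Z0 := Quotient.quot ZE_zero_ideal.
HB.instance Definition _ := ZmodQuotient.on Z0.

Lemma Z0_eqP D1 D2 :
  \pi_Z0 D1 = \pi_Z0 D2 <-> exists n : int, D1 - D2 = << n *g slzero >>.
Proof.
split=> [/eqP|h]; first by rewrite -Quotient.idealrBE => /asboolP.
by apply/eqP; rewrite -Quotient.idealrBE; apply/asboolP.
Qed.

Definition z0 e : Z0 := \pi_Z0 << e >>.

Definition Z0_mul (x y : Z0) : Z0 := \pi_Z0 (ZE_mul (repr x) (repr y)).

Lemma Z0_mulE D1 D2 : Z0_mul (\pi_Z0 D1) (\pi_Z0 D2) = \pi_Z0 (ZE_mul D1 D2).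
Proof.
have pr D : D - repr (\pi_Z0 D) \in ZE_zero_ideal.
  by rewrite Quotient.idealrBE reprK.
apply/eqP; rewrite eq_sym -Quotient.idealrBE.
rewrite -(subrKA (ZE_mul (repr (\pi_Z0 D1)) D2)) rpredD //.
  by rewrite -ZE_mulBl ZE_mulC ZE_zero_idealMl.
by rewrite -ZE_mulBr ZE_zero_idealMl.
Qed.

Lemma Z0_ind (P : Z0 -> Prop) : (forall D, P (\pi_Z0 D)) -> forall x, P x.
Proof. by move=> PD x; rewrite -[x]reprK. Qed.

Fact Z0_mulA : associative Z0_mul.
Proof.
elim/Z0_ind=> D1; elim/Z0_ind=> D2; elim/Z0_ind=> D3.
by rewrite !Z0_mulE ZE_mulA.
Qed.
HB.instance Definition _ := isSemigroup.Build Z0 Z0_mulA.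

Fact Z0_mulDl (x y z : Z0) : ((x + y)%R * z)%g = (x * z)%g + (y * z)%g.
Proof.
elim/Z0_ind: x => D1; elim/Z0_ind: y => D2; elim/Z0_ind: z => D3.
rewrite -raddfD -![(_ * _)%g]/(Z0_mul _ _) !Z0_mulE -raddfD.
by rewrite -[D2 in LHS]opprK ZE_mulBl -[- D2]sub0r ZE_mulBl ZE_mul0l sub0r opprK.
Qed.
Fact Z0_mulDr (x y z : Z0) : (x * (y + z)%R)%g = (x * y)%g + (x * z)%g.
Proof.
have C : commutative (fun x y : Z0 => (x * y)%g).
  elim/Z0_ind=> D1; elim/Z0_ind=> D2.
  by rewrite -![(_ * _)%g]/(Z0_mul _ _) !Z0_mulE ZE_mulC.
by rewrite C Z0_mulDl C [(z * x)%g]C.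
Qed.
HB.instance Definition _ := Zmodule_isRng.Build Z0 Z0_mulDl Z0_mulDr.

Lemma z00 : z0 slzero = 0.
Proof.
rewrite /z0 -[RHS](raddf0 \pi_Z0); apply/Z0_eqP; exists 1.
by rewrite subr0.
Qed.

Lemma z0M d e : z0 (d * e)%g = (z0 d * z0 e)%g.
Proof. by rewrite -[RHS]/(Z0_mul _ _) Z0_mulE ZE_mulU. Qed.

(* The additive extension of f : E -> M to Z_0[E], meaningful when f 0 = 0. *)
Section Lift.
Variables (M : zmodType) (f : E -> M).

Definition Z0_lift (x : Z0) : M := fglift (f : E -> zmodule M) (repr x).

Hypothesis f0 : f slzero = 0.

Lemma Z0_lift_pi D : Z0_lift (\pi_Z0 D) = fglift (f : E -> zmodule M) D.
Proof.
have [n] : exists n : int, repr (\pi_Z0 D) - D = << n *g slzero >>.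
  by apply/Z0_eqP; rewrite reprK.
move/(congr1 (fglift (f : E -> zmodule M))); rewrite raddfB liftU f0 scaler0.
by move/eqP; rewrite subr_eq0 => /eqP.
Qed.

Lemma Z0_liftE e : Z0_lift (z0 e) = f e.
Proof. by rewrite Z0_lift_pi fglift1. Qed.

Lemma Z0_liftB : zmod_morphism Z0_lift.
Proof.
elim/Z0_ind=> D1; elim/Z0_ind=> D2.
by rewrite -raddfB !Z0_lift_pi raddfB.
Qed.
End Lift.

Lemma Z0_gen_ind (P : Z0 -> Prop) : (forall e, P (z0 e)) ->
  (forall x y, P x -> P y -> P (x - y)) -> P 0 -> forall x, P x.
Proof.
move=> Pe PB P0; elim/Z0_ind => D; elim/freeg_int_ind: D => [e|D1 D2|].
- exact: Pe.
- by rewrite raddfB; exact: PB.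
- by rewrite raddf0.
Qed.
End Z0.

Section RngTheory.
Variable A : rngType.
Implicit Types x y z : A.

Lemma rng_mul0r x : (0%R * x)%g = 0.
Proof. by apply: (@addrI _ (0%R * x)%g); rewrite -rngDl !addr0. Qed.

Lemma rng_mulr0 x : (x * 0%R)%g = 0.
Proof. by apply: (@addrI _ (x * 0%R)%g); rewrite -rngDr !addr0. Qed.

Lemma rngBl x y z : ((x - y)%R * z)%g = (x * z)%g - (y * z)%g.
Proof. by apply/eqP; rewrite eq_sym subr_eq -rngDl subrK. Qed.

Lemma rngBr x y z : (x * (y - z)%R)%g = (x * y)%g - (x * z)%g.
Proof. by apply/eqP; rewrite eq_sym subr_eq -rngDr subrK. Qed.
End RngTheory.

Lemma Z0_liftM (E : semilatticeType) (A : rngType) (f : E -> A) :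
  f slzero = 0 -> (forall d e, f (d * e)%g = (f d * f e)%g) ->
  forall x y, Z0_lift f (x * y)%g = (Z0_lift f x * Z0_lift f y)%g.
Proof.
move=> f0 fM x y; have fB := Z0_liftB f0.
have fz : Z0_lift f 0 = 0 by rewrite -[X in Z0_lift f X](subrr 0) fB subrr.
elim/Z0_gen_ind: x => [d|x x' IHx IHx'|].
- elim/Z0_gen_ind: y => [e|y y' IHy IHy'|].
  + by rewrite -z0M !Z0_liftE.
  + by rewrite rngBr !fB rngBr IHy IHy'.
  + by rewrite rng_mulr0 fz rng_mulr0.
- by rewrite rngBl !fB rngBl IHx IHx'.
- by rewrite rng_mul0r fz rng_mul0r.
Qed.

HB.mixin Record isCStarAlgebra (R : realType) A
    of CompleteNormedModule R[i] A & Rng A := {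
  star : A -> A;
  scale_mull : forall (a : R[i]) (x y : A), ((a *: x)%R * y)%g = a *: (x * y)%g;
  scale_mulr : forall (a : R[i]) (x y : A), (x * (a *: y)%R)%g = a *: (x * y)%g;
  starK : involutive star;
  starD : {morph star : x y / x + y};
  starZ : forall (a : R[i]) (x : A), star (a *: x) = a^* *: star x;
  starM : forall x y : A, star (x * y)%g = (star y * star x)%g;
  normM_le : forall x y : A, `|(x * y)%g| <= `|x| * `|y|;
  cstar_id : forall x : A, `|(star x * x)%g| = `|x| ^+ 2 }.
#[short(type="cstarType")]
HB.structure Definition CStarAlgebra (R : realType) :=
  {A of isCStarAlgebra R A & CompleteNormedModule R[i] A & Rng A}.

HB.mixin Record isStarMorphism (R : realType) (A B : cstarType R) (f : A -> B) := {
  starhom_star : {morph f : x / star x} }.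
HB.structure Definition StarHom (R : realType) (A B : cstarType R) :=
  {f of @GRing.Linear R[i] A B *:%R f & isMultiplicative A B f &
   isStarMorphism R A B f}.
Notation "{ 'starhom' A -> B }" := (StarHom.type A B)
  (at level 0, A at level 98, B at level 99,
   format "{ 'starhom'  A  ->  B }") : type_scope.

Definition vanishes_at_infinity (T : topologicalType) (K : numDomainType)
    (V : normedZmodType K) (f : T -> V) : Prop :=
  forall e : K, 0 < e ->
    exists2 C : set T, compact C & forall x, ~ C x -> `|f x| < e.

Section ComplexComplete.
Variable R : realType.
Local Notation C := (R[i]^o).

Lemma complex_ReB (u v : R[i]) : complex.Re (u - v) = complex.Re u - complex.Re v.
Proof. by case: u v => [? ?] [? ?]. Qed.

Lemma complex_ImB (u v : R[i]) : complex.Im (u - v) = complex.Im u - complex.Im v.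
Proof. by case: u v => [? ?] [? ?]. Qed.

Lemma C_ge0_Re (z : R[i]) : 0 <= z -> (complex.Re z)%:C%C = z.
Proof. by move=> z0; rewrite RRe_real // ger0_real. Qed.

Lemma complex_complete (F : set_system C) :
  ProperFilter F -> cauchy F -> cvg F.
Proof.
move=> FF /cauchyP Fc.
have dRe (z : R[i]) : `|complex.Re z| <= complex.Re `|z|.
  by rewrite -lecR C_ge0_Re // normc_ge_Re.
have dIm (z : R[i]) : `|complex.Im z| <= complex.Re `|z|.
  rewrite -[X in _ <= complex.Re X]mul1r.
  have -> : 1 = `|'i%C : R[i]| by rewrite normc_def /= expr0n expr1n add0r sqrtr1.
  by rewrite -normrM mulrC -normrN -(ReiNIm z) dRe.
have cv (h : R[i] -> R) : (forall u v, h (u - v) = h u - h v) ->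
    (forall z, `|h z| <= complex.Re `|z|) -> cvg (h z @[z --> F]).
  move=> hB hz; apply/cauchy_cvgP/cauchy_exP => e e0.
  have e0' : 0 < e%:C%C :> R[i] by rewrite ltcR.
  have [z Fz] := Fc _ e0'; exists (h z).
  suff : F (h @^-1` ball (h z) e) by [].
  apply: filterS Fz => w; rewrite /= -!ball_normE /= => zw.
  rewrite -hB; apply: le_lt_trans (hz _) _.
  by rewrite -ltcR C_ge0_Re.
have /cvg_ex[a Fa] := cv _ complex_ReB dRe.
have /cvg_ex[b Fb] := cv _ complex_ImB dIm.
apply/cvg_ex; exists (a +i* b)%C; apply/cvgrPdist_lt => e e0.
have eE : (complex.Re e)%:C%C = e by rewrite C_ge0_Re // ltW.
have e20 : 0 < complex.Re e / 2 by rewrite divr_gt0 // -ltcR eE.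
move/cvgrPdist_lt : Fa => /(_ _ e20) Fa.
move/cvgrPdist_lt : Fb => /(_ _ e20) Fb.
apply: filterS2 Fa Fb => -[x y] /= ax By.
have -> : (a +i* b)%C - (x +i* y)%C = (a - x)%:C%C + 'i%C * (b - y)%:C%C :> R[i].
  by rewrite [LHS]complexE.
apply: le_lt_trans (ler_normD _ _) _.
rewrite normrM.
have -> : `|'i%C : R[i]| = 1 by rewrite normc_def /= expr0n expr1n add0r sqrtr1.
rewrite mul1r !normc_def /= !expr0n !addr0 !sqrtr_sqr -rmorphD -eE ltcR.
by rewrite (splitr (complex.Re e)) ltrD.
Qed.
HB.instance Definition _ := Uniform_isComplete.Build C complex_complete.
End ComplexComplete.

Section C0.
Variables (R : realType) (T : topologicalType).
Local Notation C := (R[i]^o).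

Definition C0_pred : {pred T -> C} :=
  fun f => `[< continuous f /\ vanishes_at_infinity f >].

Lemma C0_predP (f : T -> C) :
  reflect (continuous f /\ vanishes_at_infinity f) (f \in C0_pred).
Proof. exact: asboolP. Qed.

Lemma vanishesD (K : numFieldType) (V : normedZmodType K) (f g : T -> V) :
  vanishes_at_infinity f -> vanishes_at_infinity g ->
  vanishes_at_infinity (fun x => f x + g x).
Proof.
move=> vf vg e e0; have e20 : 0 < e / 2 by rewrite divr_gt0.
have [A cA fA] := vf _ e20; have [B cB gB] := vg _ e20.
exists (A `|` B); first exact: compactU.
move=> x /not_orP[Ax Bx]; apply: le_lt_trans (ler_normD _ _) _.
by rewrite (splitr e) ltrD ?fA ?gB.
Qed.

Fact C0_submod_closed : submod_closed C0_pred.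
Proof.
split.
  apply/C0_predP; split; first exact: cst_continuous.
  by move=> e e0; exists set0; [exact: compact0 | move=> x _; rewrite normr0].
move=> a f g /C0_predP[cf vf] /C0_predP[cg vg]; apply/C0_predP; split.
  move=> x; apply: cvgD; last exact: cg.
  by apply: cvgZr; exact: cf.
apply: vanishesD => // e e0.
have e'0 : 0 < e / (`|a| + 1) by rewrite divr_gt0 // ltr_wpDl.
have [A cA fA] := vf _ e'0; exists A => // x /fA; rewrite ltr_pdivlMr ?ltr_wpDl //.
apply: le_lt_trans; rewrite normrM mulrC ler_wpM2l //.
by rewrite lerDl.
Qed.
HB.instance Definition _ :=
  GRing.isSubmodClosed.Build R[i] (T -> C) C0_pred C0_submod_closed.

Record C0 := MkC0 { C0_fun :> T -> C; _ : C0_fun \in C0_pred }.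
HB.instance Definition _ := [isSub for C0_fun].
HB.instance Definition _ := [Choice of C0 by <:].
HB.instance Definition _ := [SubChoice_isSubLmodule of C0 by <:].

Lemma C0P (f : C0) : continuous f /\ vanishes_at_infinity f.
Proof. by apply/C0_predP; case: f. Qed.

Lemma C0_eq (f g : C0) : (forall x, f x = g x) -> f = g.
Proof. by move=> fg; apply/val_inj/funext. Qed.

(* Norms of R[i]-modules are R[i]-valued. When T is empty, the supremum is 0. *)
Definition C0_norm (f : C0) : R[i] :=
  (sup (range (fun x => complex.Re `|f x|)))%:C%C.

Lemma C0_bounded (f : C0) : exists M : R, forall x, complex.Re `|f x| <= M.
Proof.
have [cf vf] := C0P f; have [A cA fA] := vf 1 ltr01.
pose g x : R := complex.Re `|f x|.
have cg : continuous g.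
  move=> x; apply/cvgrPdist_lt => e e0.
  have e0' : 0 < e%:C%C :> R[i] by rewrite ltcR.
  have /cvgrPdist_lt/(_ _ e0') := cf x; apply: filterS => y.
  move=> /(le_lt_trans _) h; rewrite -ltcR; apply: h.
  apply: le_trans (ler_dist_dist _ _).
  by apply: le_trans (normc_ge_Re _); rewrite lecR complex_ReB.
have [M [_ MA]] : bounded_set (g @` A).
  apply: compact_bounded; apply: continuous_compact => //.
  exact/continuous_subspaceT.
exists (Num.max (M + 1) 1) => x; rewrite le_max.
have [Ax|/fA fx] := pselect (A x).
  have M1 : M < M + 1 by rewrite ltrDl.
  apply/orP; left; apply: le_trans (ler_norm _) _.
  by apply: (MA _ M1); exists x.
by apply/orP; right; rewrite -lecR C_ge0_Re // ltW.
Qed.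

Lemma C0_norm_ge (f : C0) x : `|f x| <= C0_norm f.
Proof.
rewrite -[X in X <= _]C_ge0_Re // lecR; apply: ub_le_sup; last by exists x.
by have [M fM] := C0_bounded f; exists M => _ [y _ <-].
Qed.

Lemma C0_norm_ge0 (f : C0) : 0 <= C0_norm f.
Proof.
have [[x _]|/set0P/negP/negPn/eqP T0] := pselect (@setT T !=set0).
  exact: le_trans (C0_norm_ge f x).
by rewrite /C0_norm T0 image_set0 sup0.
Qed.

Lemma C0_norm_le (f : C0) (M : R[i]) :
  0 <= M -> (forall x, `|f x| <= M) -> C0_norm f <= M.
Proof.
move=> M0 fM; rewrite -[M]C_ge0_Re // lecR.
have [[x _]|/set0P/negP/negPn/eqP T0] := pselect (@setT T !=set0).
  apply: ge_sup; first by exists (complex.Re `|f x|), x.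
  by move=> _ [y _ <-]; rewrite -lecR !C_ge0_Re.
by rewrite T0 image_set0 sup0 -ler0c C_ge0_Re.
Qed.

Fact C0_normD (f g : C0) : C0_norm (f + g) <= C0_norm f + C0_norm g.
Proof.
apply: C0_norm_le => [|x]; first by rewrite addr_ge0 ?C0_norm_ge0.
by apply: le_trans (ler_normD _ _) _; rewrite lerD ?C0_norm_ge.
Qed.

Fact C0_normZ (a : R[i]) (f : C0) : C0_norm (a *: f) = `|a| * C0_norm f.
Proof.
have nZ (b : R[i]) (h : C0) : C0_norm (b *: h) <= `|b| * C0_norm h.
  apply: C0_norm_le => [|x]; first by rewrite mulr_ge0 ?C0_norm_ge0.
  by rewrite normrM ler_wpM2l ?C0_norm_ge.
apply/eqP; rewrite eq_le nZ /=; have [->|a0] := eqVneq a 0.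
  by rewrite normr0 mul0r C0_norm_ge0.
rewrite -ler_pdivlMl ?normr_gt0 // -normfV.
by rewrite -[X in C0_norm X <= _]scale1r -(mulVf a0) -scalerA.
Qed.

Fact C0_norm0_eq0 (f : C0) : C0_norm f = 0 -> f = 0.
Proof.
move=> f0; apply: C0_eq => x; apply/eqP; rewrite -normr_le0 -f0.
exact: C0_norm_ge.
Qed.

HB.instance Definition _ := @Lmodule_isNormed.Build R[i] C0 C0_norm
  C0_normD C0_normZ C0_norm0_eq0.

Lemma C0_normE (f : C0) : `|f| = C0_norm f. Proof. by []. Qed.


Lemma C0_le_divn (e : R[i]) n m : 0 < e -> (n <= m.+1)%N -> (e / m.+1%:R) *+ n <= e.
Proof.
move=> e0 nm; apply: (@le_trans _ _ ((e / m.+1%:R) *+ m.+1)).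
  by apply: ler_wpMn2l => //; rewrite divr_ge0 // ltW.
by rewrite -[X in X <= _]mulr_natr divfK ?pnatr_eq0 ?lexx.
Qed.

Lemma C0_complete (F : set_system C0) : ProperFilter F -> cauchy F -> cvg F.
Proof.
move=> FF /cauchyP Fc.
have Fb e : 0 < e -> exists f : C0, F [set h | `|f - h| < e].
  by move=> /Fc[f Ff]; exists f; move: Ff; rewrite -ball_normE.
pose ev x (h : C0) : C := h x.
have cF x : cvg (ev x @ F).
  apply: complex_complete; apply/cauchy_exP => e /Fb[f Ff]; exists (f x).
  suff : F (ev x @^-1` ball (f x : C) e) by [].
  apply: filterS Ff => h; rewrite /= -ball_normE /=.
  by apply: le_lt_trans; exact: (C0_norm_ge (f - h) x).
pose g x : C := lim (ev x @ F).
have gF x e : 0 < e -> F [set h : C0 | `|g x - h x| < e].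
  by move=> e0; have /cvgrPdist_lt := cF x; exact.
have fg (f : C0) e : 0 < e -> F [set h | `|f - h| < e] ->
    forall x, `|f x - g x| <= e *+ 2.
  move=> e0 Ff x; have [h [/= fh gh]] := filter_ex (filterI Ff (gF x _ e0)).
  rewrite -[f x](subrK (h x)) -addrA (le_trans (ler_normD _ _)) // mulr2n.
  rewrite lerD // ltW // ?[`|h x - _|]distrC //.
  exact: le_lt_trans (C0_norm_ge (f - h) x) fh.
have gC : g \in C0_pred.
  apply/C0_predP; split.
    move=> x; apply/cvgrPdist_lt => e e0.
    have e6 : 0 < e / 6 by rewrite divr_gt0.
    have [f Ff] := Fb _ e6; have {}Ff := fg _ _ e6 Ff.
    have /cvgrPdist_lt/(_ _ e6) := (C0P f).1 x; apply: filterS => y fxy.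
    have -> : g x - g y = - (f x - g x) + ((f x - f y) + (f y - g y)).
      by rewrite opprB !addrA subrK subrK.
    apply: le_lt_trans (ler_normD _ _) _; rewrite normrN.
    apply: (@le_lt_trans _ _ ((e / 6) *+ 2 + (`|f x - f y| + (e / 6) *+ 2))).
      by rewrite lerD // (le_trans (ler_normD _ _)) // lerD.
    apply: (@lt_le_trans _ _ ((e / 6) *+ 2 + ((e / 6) + (e / 6) *+ 2))).
      by rewrite ltrD2l ltrD2r.
    rewrite addrA -mulrSr -mulrnDr; exact: (C0_le_divn (m := 5)).
  move=> e e0; have e4 : 0 < e / 4 by rewrite divr_gt0.
  have [f Ff] := Fb _ e4; have {}Ff := fg _ _ e4 Ff.
  have [A cA fA] := (C0P f).2 _ e4; exists A => // x /fA fx.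
  have -> : g x = f x - (f x - g x) by rewrite subKr.
  apply: le_lt_trans (ler_normB _ _) _.
  apply: (@lt_le_trans _ _ ((e / 4) + (e / 4) *+ 2)); first by rewrite ltr_leD.
  rewrite -mulrS; exact: (C0_le_divn (m := 3)).
apply/cvg_ex; exists (MkC0 gC); apply/cvgrPdist_lt => e e0.
have e4 : 0 < e / 4 by rewrite divr_gt0.
have [f Ff] := Fb _ e4; have fgx := fg _ _ e4 Ff.
apply: filterS Ff => h /= fh.
rewrite -[X in `|X|](subrKA f); apply: le_lt_trans (ler_normD _ _) _.
have Gf : `|MkC0 gC - f| <= (e / 4) *+ 2.
  apply: C0_norm_le => [|x]; first by rewrite mulrn_wge0 // ltW.
  by rewrite distrC; exact: fgx.
apply: (@lt_le_trans _ _ ((e / 4) *+ 2 + (e / 4))); first by rewrite ler_ltD.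
rewrite -mulrSr; exact: (C0_le_divn (m := 3)).
Qed.
HB.instance Definition _ := Uniform_isComplete.Build C0 C0_complete.

Fact C0_mul_subproof (f g : C0) : (fun x => f x * g x : C) \in C0_pred.
Proof.
have [[cf _] [cg vg]] := (C0P f, C0P g); apply/C0_predP; split.
  by move=> x; apply: (@cvgM R[i]); [exact: cf | exact: cg].
move=> e e0; have [M0 M1] : 0 <= `|f| /\ 0 < `|f| + 1 by rewrite ltr_wpDl.
have [A cA gA] := vg _ (divr_gt0 e0 M1); exists A => // x /gA.
rewrite ltr_pdivlMr // => h; apply: le_lt_trans h.
rewrite normrM mulrC ler_wpM2l // (le_trans (C0_norm_ge f x)) // lerDl //.
Qed.
Definition C0_mul (f g : C0) : C0 := MkC0 (C0_mul_subproof f g).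

Fact C0_star_subproof (f : C0) : (fun x => (f x : R[i])^* : C) \in C0_pred.
Proof.
have [cf vf] := C0P f; apply/C0_predP; split.
  move=> x; apply/cvgrPdist_lt => e e0.
  have /cvgrPdist_lt/(_ _ e0) := cf x; apply: filterS => y.
  by rewrite -rmorphB norm_conjC.
by move=> e /vf[A cA fA]; exists A => // x /fA; rewrite norm_conjC.
Qed.
Definition C0_star (f : C0) : C0 := MkC0 (C0_star_subproof f).

Fact C0_mulA : associative C0_mul.
Proof. by move=> f g h; apply: C0_eq => x /=; rewrite mulrA. Qed.
HB.instance Definition _ := isSemigroup.Build C0 C0_mulA.

Fact C0_mulDl (f g h : C0) : ((f + g)%R * h)%g = (f * h)%g + (g * h)%g.
Proof. by apply: C0_eq => x; exact: mulrDl. Qed.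
Fact C0_mulDr (f g h : C0) : (f * (g + h)%R)%g = (f * g)%g + (f * h)%g.
Proof. by apply: C0_eq => x; exact: mulrDr. Qed.
HB.instance Definition _ := Zmodule_isRng.Build C0 C0_mulDl C0_mulDr.

Fact C0_scale_mull (a : R[i]) (f g : C0) : ((a *: f)%R * g)%g = a *: (f * g)%g.
Proof. by apply: C0_eq => x; rewrite /= -mulrA. Qed.
Fact C0_scale_mulr (a : R[i]) (f g : C0) : (f * (a *: g)%R)%g = a *: (f * g)%g.
Proof. by apply: C0_eq => x; exact: mulrCA. Qed.
Fact C0_starK : involutive C0_star.
Proof. by move=> f; apply: C0_eq => x; exact: conjCK. Qed.
Fact C0_starD : {morph C0_star : f g / f + g}.
Proof. by move=> f g; apply: C0_eq => x; exact: rmorphD. Qed.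
Fact C0_starZ (a : R[i]) (f : C0) : C0_star (a *: f) = a^* *: C0_star f.
Proof. by apply: C0_eq => x; exact: rmorphM. Qed.
Fact C0_starM (f g : C0) : C0_star (f * g)%g = (C0_star g * C0_star f)%g.
Proof. by apply: C0_eq => x; rewrite /= rmorphM mulrC. Qed.
Fact C0_normM (f g : C0) : `|(f * g)%g| <= `|f| * `|g|.
Proof.
apply: C0_norm_le => [|x]; first by rewrite mulr_ge0.
by rewrite normrM ler_pM ?C0_norm_ge.
Qed.
Fact C0_cstar_id (f : C0) : `|(C0_star f * f)%g| = `|f| ^+ 2.
Proof.
apply/eqP; rewrite eq_le; apply/andP; split.
  apply: C0_norm_le => [|x]; first by rewrite exprn_ge0.
  by rewrite /= normrM norm_conjC -expr2 lerXn2r ?nnegrE // C0_norm_ge.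
rewrite -[X in _ <= X]sqrtCK lerXn2r ?nnegrE ?sqrtC_ge0 //.
apply: C0_norm_le => [|x]; first by rewrite sqrtC_ge0.
rewrite -(@ler_pXn2r _ 2) ?nnegrE ?sqrtC_ge0 // sqrtCK.
apply: le_trans (C0_norm_ge _ x).
by rewrite /= normrM norm_conjC expr2.
Qed.
HB.instance Definition _ := isCStarAlgebra.Build R C0 C0_scale_mull
  C0_scale_mulr C0_starK C0_starD C0_starZ C0_starM C0_normM C0_cstar_id.
End C0.

Section C0Z.
Variable T : topologicalType.

Definition C0Z_pred : {pred T -> int} := fun f =>
  `[< continuous (f : T -> discrete_topology int) /\ vanishes_at_infinity f >].

Lemma C0Z_predP (f : T -> int) :
  reflect (continuous (f : T -> discrete_topology int) /\
           vanishes_at_infinity f) (f \in C0Z_pred).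
Proof. exact: asboolP. Qed.

Lemma continuous_discreteP (I : choiceType) (f : T -> I) :
  continuous (f : T -> discrete_topology I) <->
  forall x, \forall y \near x, f y = f x.
Proof.
split=> [cf x|cf x A]; last first.
  move=> Afx; apply: (filterS _ (cf x)) => y /= ->.
  by move: Afx; rewrite nbhs_principalE => /principal_filterP.
apply: (cf x [set f x]).
by rewrite nbhs_principalE; apply/principal_filterP.
Qed.

Fact C0Z_zmod_closed : zmod_closed C0Z_pred.
Proof.
split.
  apply/C0Z_predP; split; first exact: cst_continuous.
  by move=> e e0; exists set0; [exact: compact0 | move=> x _; rewrite normr0].
move=> f g /C0Z_predP[/continuous_discreteP cf vf].
move=> /C0Z_predP[/continuous_discreteP cg vg]; apply/C0Z_predP; split.
  apply/continuous_discreteP => x; apply: filterS2 (cf x) (cg x).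
  by move=> y fy gy; rewrite !fctE fy gy.
move=> e e0; have [A cA fA] := vf 1 ltr01; have [B cB gB] := vg 1 ltr01.
exists (A `|` B); first exact: compactU.
have n0 (n : int) : `|n| < 1 -> n = 0.
  by rewrite -[1]add0r ltzD1 normr_le0 => /eqP.
by move=> x /not_orP[/fA/n0 fx /gB/n0 gx]; rewrite !fctE fx gx subrr normr0.
Qed.
HB.instance Definition _ :=
  GRing.isZmodClosed.Build (T -> int) C0Z_pred C0Z_zmod_closed.

Record C0Z := MkC0Z { C0Z_fun :> T -> int; _ : C0Z_fun \in C0Z_pred }.
HB.instance Definition _ := [isSub for C0Z_fun].
HB.instance Definition _ := [Choice of C0Z by <:].
HB.instance Definition _ := [SubChoice_isSubZmodule of C0Z by <:].

Lemma C0ZP (f : C0Z) :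
  continuous (f : T -> discrete_topology int) /\ vanishes_at_infinity f.
Proof. by apply/C0Z_predP; case: f. Qed.

Lemma C0Z_eq (f g : C0Z) : (forall x, f x = g x) -> f = g.
Proof. by move=> fg; apply/val_inj/funext. Qed.

Fact C0Z_mul_subproof (f g : C0Z) : (fun x => f x * g x) \in C0Z_pred.
Proof.
have [/continuous_discreteP cf vf] := C0ZP f.
have [/continuous_discreteP cg vg] := C0ZP g; apply/C0Z_predP; split.
  by apply/continuous_discreteP => x; apply: filterS2 (cf x) (cg x) => y -> ->.
move=> e e0; have [A cA fA] := vf 1 ltr01; exists A => // x /fA.
by rewrite -[1]add0r ltzD1 normr_le0 => /eqP ->; rewrite mul0r normr0.
Qed.
Definition C0Z_mul (f g : C0Z) : C0Z := MkC0Z (C0Z_mul_subproof f g).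

Fact C0Z_mulA : associative C0Z_mul.
Proof. by move=> f g h; apply: C0Z_eq => x /=; rewrite mulrA. Qed.
HB.instance Definition _ := isSemigroup.Build C0Z C0Z_mulA.

Fact C0Z_mulDl (f g h : C0Z) : ((f + g)%R * h)%g = (f * h)%g + (g * h)%g.
Proof. by apply: C0Z_eq => x; exact: mulrDl. Qed.
Fact C0Z_mulDr (f g h : C0Z) : (f * (g + h)%R)%g = (f * g)%g + (f * h)%g.
Proof. by apply: C0Z_eq => x; exact: mulrDr. Qed.
HB.instance Definition _ := Zmodule_isRng.Build C0Z C0Z_mulDl C0Z_mulDr.

Variable R : realType.
Fact C0Z_C0_subproof (f : C0Z) : (fun x => (f x)%:~R : R[i]^o) \in @C0_pred R T.
Proof.
have [/continuous_discreteP cf vf] := C0ZP f; apply/C0_predP; split.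
  by move=> x A /= Afx; apply: (filterS _ (cf x)) => y /= ->; exact: nbhs_singleton.
move=> e e0; have [A cA fA] := vf 1 ltr01; exists A => // x /fA.
by rewrite -[1]add0r ltzD1 normr_le0 => /eqP ->; rewrite normr0.
Qed.
Definition C0Z_C0 (f : C0Z) : C0 R T := MkC0 (C0Z_C0_subproof f).
End C0Z.

Section UniversalCStar.
Variable R : realType.

Record cstar_subalgebra (A : cstarType R) (S : set A) : Prop := {
  csub_closed : closed S;
  csub0 : S 0;
  csubD : forall x y, S x -> S y -> S (x + y);
  csubZ : forall (a : R[i]) x, S x -> S (a *: x);
  csubM : forall x y, S x -> S y -> S (x * y)%g;
  csub_star : forall x, S x -> S (star x) }.

Definition is_projection (A : cstarType R) (p : A) : Prop :=
  star p = p /\ (p * p)%g = p.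

Record projection_family (E : semilatticeType) (A : cstarType R) (p : E -> A) :
    Prop := {
  pf_proj : forall e, is_projection (p e);
  pf0 : p slzero = 0;
  pfM : forall d e, p (d * e)%g = (p d * p e)%g }.

(* A realisation of C*_u(E): a C*-algebra generated by projections p_e subject
   to p_0 = 0 and p_{de} = p_d p_e, and universal for these relations. It is
   unique up to a unique *-isomorphism compatible with the p_e.              *)
Record universal_cstar (E : semilatticeType) := {
  Cu_alg :> cstarType R;
  Cu_proj : E -> Cu_alg;
  Cu_family : projection_family Cu_proj;
  Cu_generated : forall S : set Cu_alg,
    cstar_subalgebra S -> (forall e, S (Cu_proj e)) -> S = setT;
  Cu_universal : forall (B : cstarType R) (q : E -> B), projection_family q ->
    exists f : {starhom Cu_alg -> B},
      (forall e, f (Cu_proj e) = q e) /\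
      forall f' : {starhom Cu_alg -> B},
        (forall e, f' (Cu_proj e) = q e) -> f' =1 f }.

Definition Cu_lift (E : semilatticeType) (U : universal_cstar E)
    (B : cstarType R) (q : E -> B) (qP : projection_family q) :
  {starhom U -> B} := sval (cid (Cu_universal U qP)).

Lemma Cu_liftE (E : semilatticeType) (U : universal_cstar E)
    (B : cstarType R) (q : E -> B) (qP : projection_family q) (e : E) :
  Cu_lift U qP (Cu_proj U e) = q e.
Proof. by rewrite /Cu_lift; case: cid => f []. Qed.

(* The identification of Z_0[E] with the Z-span of the p_e in C*_u(E). *)
Definition Cu_span (E : semilatticeType) (U : universal_cstar E) :
  Z0 E -> U := Z0_lift (Cu_proj U).

Section Span.
Variables (E : semilatticeType) (U : universal_cstar E).

Lemma Cu_spanE e : Cu_span U (z0 e) = Cu_proj U e.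
Proof. exact/Z0_liftE/(pf0 (Cu_family U)). Qed.

Lemma Cu_spanB : zmod_morphism (Cu_span U).
Proof. exact/Z0_liftB/(pf0 (Cu_family U)). Qed.

Lemma Cu_span0 : Cu_span U 0 = 0.
Proof. by rewrite -[X in Cu_span U X](subrr 0) Cu_spanB subrr. Qed.

Lemma Cu_spanM x y : Cu_span U (x * y)%g = (Cu_span U x * Cu_span U y)%g.
Proof. by have [_ p0 pM] := Cu_family U; exact: Z0_liftM. Qed.

Lemma Cu_span_star x : star (Cu_span U x) = Cu_span U x.
Proof.
have starN (z : U) : star (- z) = - star z.
  by rewrite -scaleN1r starZ rmorphN rmorph1 scaleN1r.
elim/Z0_gen_ind: x => [e|x y IHx IHy|].
- by rewrite Cu_spanE; have [/(_ e)[]] := Cu_family U.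
- by rewrite Cu_spanB starD starN IHx IHy.
- by rewrite Cu_span0 -(scale0r 0) starZ rmorph0 !scale0r.
Qed.
End Span.

Section Induced.
Variables (E' E : semilatticeType) (U' : universal_cstar E').

Fact Cu_map_family (U : universal_cstar E) (phi : {rng Z0 E' -> Z0 E}) :
  projection_family (fun e => Cu_span U (phi (z0 e))).
Proof.
have M d e : Cu_span U (phi (z0 (d * e)%g)) =
    (Cu_span U (phi (z0 d)) * Cu_span U (phi (z0 e)))%g.
  by rewrite z0M gmulfM Cu_spanM.
split=> [e||//]; last by rewrite z00 raddf0 Cu_span0.
by split; [exact: Cu_span_star | rewrite -M mulss].
Qed.

Definition Cu_map (U : universal_cstar E) (phi : {rng Z0 E' -> Z0 E}) :
  {starhom U' -> U} := Cu_lift U' (Cu_map_family U phi).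

Fact Cu_map_C0_family (T : topologicalType) (eps : {rng Z0 E' -> C0Z T}) :
  projection_family (fun e => C0Z_C0 R (eps (z0 e))).
Proof.
have M d e : C0Z_C0 R (eps (z0 (d * e)%g)) =
    (C0Z_C0 R (eps (z0 d)) * C0Z_C0 R (eps (z0 e)))%g.
  by rewrite z0M gmulfM; apply: C0_eq => x; exact: intrM.
split=> [e||//]; last by rewrite z00 raddf0; apply: C0_eq.
split; last by rewrite -M mulss.
by apply: C0_eq => x; exact: rmorph_int.
Qed.

Definition Cu_map_C0 (T : topologicalType) (eps : {rng Z0 E' -> C0Z T}) :
  {starhom U' -> C0 R T} := Cu_lift U' (Cu_map_C0_family eps).
End Induced.
End UniversalCStar.

Definition is_action (G : groupType) (X : Type) (a : G -> X -> X) : Prop :=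
  (forall x, a 1%g x = x) /\ (forall g h x, a (g * h)%g x = a g (a h x)).

Record gsemilattice (G : groupType) := {
  gsl_sort :> semilatticeType;
  gsl_act : G -> gsl_sort -> gsl_sort;
  gsl_actP : is_action gsl_act;
  gsl_actM : forall g d e, gsl_act g (d * e)%g = (gsl_act g d * gsl_act g e)%g }.

(* Each td_act g is a homeomorphism: its inverse td_act g^-1 is continuous. *)
Record td_system (G : groupType) := {
  td_space :> topologicalType;
  td_hausdorff : hausdorff_space td_space;
  td_locally_compact : locally_compact [set: td_space];
  td_second_countable : @second_countable td_space;
  td_totally_disconnected : totally_disconnected [set: td_space];
  td_act : G -> td_space -> td_space;
  td_actP : is_action td_act;
  td_act_continuous : forall g, continuous (td_act g) }.

Section InducedActions.
Variables (R : realType) (G : groupType).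

Lemma gsl_act0 (E : gsemilattice G) (g : G) : gsl_act g (slzero : E) = slzero.
Proof.
have [a1 aM] := gsl_actP E.
have gK : slzero = gsl_act g (gsl_act g^-1%g slzero) :> E.
  by rewrite -aM mulgV a1.
have <- : (gsl_act g (slzero : E) * slzero)%g = gsl_act g slzero.
  by rewrite [X in (_ * X)%g]gK -gsl_actM mul0s.
by rewrite mulsC mul0s.
Qed.

Definition Z0_act (E : gsemilattice G) (g : G) : Z0 E -> Z0 E :=
  Z0_lift (fun e => z0 (gsl_act g e)).

Fact Cu_act_family (E : gsemilattice G) (U : universal_cstar R E) (g : G) :
  projection_family (fun e => Cu_proj U (gsl_act g e)).
Proof.
have [pP p0 pM] := Cu_family U; split=> [e||d e]; first exact: pP.
- by rewrite gsl_act0.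
- by rewrite gsl_actM pM.
Qed.

Definition Cu_act (E : gsemilattice G) (U : universal_cstar R E) (g : G) :
  {starhom U -> U} := Cu_lift U (Cu_act_family U g).

Variable Omega : td_system G.

Lemma vanishes_act (K : numDomainType) (V : normedZmodType K) (f : Omega -> V)
    (g : G) :
  vanishes_at_infinity f -> vanishes_at_infinity (fun x => f (td_act g x)).
Proof.
have [a1 aM] := td_actP Omega.
move=> vf e /vf[A cA fA]; exists (td_act g^-1%g @` A).
  apply: continuous_compact cA; apply: continuous_subspaceT.
  exact: td_act_continuous.
move=> x Ax; apply: fA => Agx; apply: Ax; exists (td_act g x) => //.
by rewrite -aM mulVg a1.
Qed.

Fact C0_act_subproof (g : G) (f : C0 R Omega) :
  (fun x => f (td_act g^-1%g x)) \in @C0_pred R Omega.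
Proof.
have [cf vf] := C0P f; apply/C0_predP; split; last exact: vanishes_act.
move=> x; apply: (@continuous_comp _ _ _ (td_act g^-1%g) f).
  exact: td_act_continuous.
exact: cf.
Qed.

Definition C0_act (g : G) (f : C0 R Omega) : C0 R Omega :=
  MkC0 (C0_act_subproof g f).

Fact C0Z_act_subproof (g : G) (f : C0Z Omega) :
  (fun x => f (td_act g^-1%g x)) \in @C0Z_pred Omega.
Proof.
have [cf vf] := C0ZP f; apply/C0Z_predP; split; last exact: vanishes_act.
move=> x.
apply: (@continuous_comp _ _ _ (td_act g^-1%g) (f : Omega -> discrete_topology int)).
  exact: td_act_continuous.
exact: cf.
Qed.

Definition C0Z_act (g : G) (f : C0Z Omega) : C0Z Omega :=
  MkC0Z (C0Z_act_subproof g f).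
End InducedActions.

(* Exactness of ... -> X 2 -> X 1 -> X 0 -> Y -> 0. *)
Definition long_exact (X : nat -> zmodType) (Y : zmodType) (eps : X 0 -> Y)
    (phi : forall k, X k.+1 -> X k) : Prop :=
  [/\ forall y, exists x, eps x = y,
      forall x, eps x = 0 <-> exists y, phi 0 y = x
    & forall k x, phi k x = 0 <-> exists y, phi k.+1 y = x].

Section Resolutions.
Variables (R : realType) (G : groupType) (Omega : td_system G).
Variable E : nat -> gsemilattice G.

Record algebraic_independent_resolution (eps : {rng Z0 (E 0) -> C0Z Omega})
    (phi : forall k, {rng Z0 (E k.+1) -> Z0 (E k)}) : Prop := {
  air_eps_equivariant : forall g x, eps (Z0_act g x) = C0Z_act g (eps x);
  air_phi_equivariant : forall k g x, phi k (Z0_act g x) = Z0_act g (phi k x);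
  air_exact : @long_exact (fun k => Z0 (E k)) (C0Z Omega) eps (fun k => phi k) }.

Record independent_resolution (U : forall k, universal_cstar R (E k))
    (eps : {starhom U 0 -> C0 R Omega})
    (phi : forall k, {starhom U k.+1 -> U k}) : Prop := {
  ir_eps_equivariant : forall g x, eps (Cu_act (U 0) g x) = C0_act g (eps x);
  ir_phi_equivariant : forall k g x,
    phi k (Cu_act (U k.+1) g x) = Cu_act (U k) g (phi k x);
  ir_exact : @long_exact (fun k => U k) (C0 R Omega) eps (fun k => phi k) }.
End Resolutions.

(* Main.v *)
Require Import Defs.
From HB Require Import structures.
From mathcomp Require Import all_boot all_order all_algebra.
From mathcomp Require Import complex freeg.
From mathcomp Require Import all_classical reals topology normedtype.
From mathcomp Require Import sequences ring.

(** In a C*-algebra a linear combination of pairwise orthogonal projections is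
    as large as its largest coefficient: the norm of [\sum_i a_i p_i] is the
    maximum of [|a_i|] over the nonzero [p_i]. All of the theorem rests on this,
    because every element of the linear span D(E) of the generating projections
    of C*_u(E) is such a combination, with the [p_i] idempotents of Z_0[E]: the
    Boolean operations that make finitely many commuting idempotents orthogonal
    have integer coefficients ([lspan_orthogonal]).

    Let [f] be a *-homomorphism on C*_u(E) and [z = \sum_i a_i p_i] an element
    of D(E) in this form. Dropping the terms with [f p_i = 0] changes [z] by an
    element [y] of the span of the integral part of the kernel of [f], and leaves
    [z - y], all of whose coefficients are visible in [f z]; therefore
    [|z - y| <= |f z|] ([proj_span_trim]). There are two consequences.

    The first is that the range of [f] contains every limit of images of D(E)
    ([starhom_range_closed]): the successive differences of an approximating
    sequence can be lifted without increase of norm, and the lifts form a Cauchy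
    series. The second is that [x] with [f x = 0] is a limit of combinations of
    idempotents of Z_0[E] killed by [f]: if [z] in D(E) is close to [x] then [f z]
    is small, so [y] is close to [x] too. When algebraic exactness provides
    preimages of those idempotents under the next map [h], [x] is a limit of
    images of [h], hence in its range ([starhom_kernel_range]).

    What remains is to connect the integral and the analytic levels. An element
    of Z_0[E] is zero as soon as its image in C*_u(E) is, since the functions
    [e |-> (d e = d)], for [d] nonzero, are characters that separate the points
    of Z_0[E] ([Cu_span_inj]). The combinations of integer-valued functions are
    dense in C_0(Omega), since Omega has a base of compact open sets
    ([locally_constant_dense]). That *-homomorphisms are continuous is the
    standard fact that they are contractive ([starhom_norm]); it is obtained here
    without spectral theory, from the single observation that the imaginary part
    of a unitary has norm at most one ([sum_sqr1_norm_le1]), which also gives the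
    upper bound for the norm of [\sum_i a_i p_i]. Equivariance and the vanishing
    of composites are checked on generators. *)

Set Implicit Arguments.
Unset Strict Implicit.
Unset Printing Implicit Defensive.

Import Order.TTheory GRing.Theory Num.Theory.
Import numFieldNormedType.Exports.
Local Open Scope classical_set_scope.
Local Open Scope ring_scope.
Local Open Scope quotient_scope.

(** * Compact open sets in totally disconnected spaces *)

Section CompactOpen.
Variable T : topologicalType.
Hypothesis hT : hausdorff_space T.
Hypothesis lcT : locally_compact [set: T].

Lemma compact_nbhs (x : T) : exists2 K : set T, compact K & nbhs x K.
Proof.
have [W Wx [cW _]] := @lcT x I; exists W => //.
by rewrite withinET in Wx.
Qed.

Lemma nbhs_closure (x : T) (V : set T) : nbhs x V ->
  exists2 N : set T, nbhs x N & closure N `<=` V.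
Proof.
have [K cK Kx] := compact_nbhs x.
exact: (compact_regular hT cK Kx).
Qed.

(** If the closures of the open neighbourhoods of [A] all met [B], they would
    accumulate at a point of [B]; but a point outside [A] has a closed
    neighbourhood disjoint from [A]. *)
Lemma compact_separation (A B : set T) : compact A -> compact B ->
  A `&` B = set0 -> exists O : set T, [/\ open O, A `<=` O & closure O `&` B = set0].
Proof.
move=> cA cB AB; apply: contrapT => nO.
pose F := filter_from [set O : set T | open O /\ A `<=` O]
  (fun O => closure O `&` B).
have FF : ProperFilter F.
  apply: filter_from_proper; last first.
    move=> O [oO AO]; apply/set0P/negP => /eqP OB; apply: nO.
    by exists O.
  apply: filter_from_filter; first by exists setT; split => //; exact: openT.
  move=> O P [oO AO] [oP AP]; exists (O `&` P).
    by split; [exact: openI | rewrite subsetI].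
  by move=> y [/closureI[? ?] ?].
have FB : F B by exists setT => [|y []//]; split => //; exact: openT.
have [p [Bp clp]] := cB F FF FB.
have Ap : nbhs p (~` A).
  apply: open_nbhs_nbhs; split; first exact: closed_openC (compact_closed hT cA).
  by move=> Ap; have : (A `&` B) p by []; rewrite AB.
have [N Np NA] := nbhs_closure Ap.
pose O := ~` closure N.
have FO : F (closure O `&` B).
  exists O => //; split; first exact/closed_openC/closed_closure.
  by move=> y Ay /NA.
have [y [[Oy _] Ny]] := clp _ _ FO (nbhs_interior Np).
have [z [+ Nz]] := Oy _ Ny; apply.
exact: subset_closure Nz.
Qed.

(** The relatively clopen subsets of [K] that contain [x]; their intersection
    is the quasi-component of [x] in [K]. *)
Definition clopen_in (K : set T) (x : T) : set (set T) :=
  [set C | [/\ C `<=` K, closed C, closed (K `\` C) & C x]].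

Lemma clopen_inI K x C D :
  clopen_in K x C -> clopen_in K x D -> clopen_in K x (C `&` D).
Proof.
move=> [CK cC cKC Cx] [DK cD cKD Dx]; split => //.
- by move=> y [/CK].
- exact: closedI.
- by rewrite setDIr; exact: closedU.
Qed.

(** The family is directed, so compactness of [K] outside [W] forces one of its
    members to avoid the complement of [W]. *)
Lemma quasi_component_sub K x (W : set T) : compact K -> K x -> open W ->
  \bigcap_(C in clopen_in K x) C `<=` W -> exists2 C, clopen_in K x C & C `<=` W.
Proof.
move=> cK Kx oW QW; apply: contrapT => nC.
pose F := filter_from (clopen_in K x) (fun C => C `\` W).
have KK : clopen_in K x K.
  by split => //; [exact: compact_closed hT cK | rewrite setDv; exact: closed0].
have FF : ProperFilter F.
  apply: filter_from_proper; last first.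
    move=> C KC; apply/set0P/negP => /eqP; rewrite setD_eq0 => CW; apply: nC.
    by exists C.
  apply: filter_from_filter; first by exists K.
  move=> C D KC KD; exists (C `&` D); first exact: clopen_inI.
  by move=> y [[]].
have FK : F K by exists K => // y [].
have [p [Kp clp]] := cK F FF FK.
have pC (C : set T) : F C -> closed C -> C p.
  by move=> FC cC; rewrite (closure_id C).1// => B Bp; exact: clp.
have : (~` W) p.
  by apply: pC; [exists K => // y [] | exact: open_closedC].
apply; apply: QW => C KC; case: (KC) => _ cC _ _; apply: pC => //.
by exists C => // y [].
Qed.

(** In a compact space quasi-components are components. A separation of the
    quasi-component extends to disjoint open sets, these cover some relatively
    clopen set, and cutting that set along them gives a smaller one that misses
    one half of the quasi-component. *)
Lemma quasi_component_connected K x : compact K -> K x ->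
  connected (\bigcap_(C in clopen_in K x) C).
Proof.
move=> cK Kx; set Q := \bigcap_(C in _) C.
have QK : Q `<=` K.
  move=> y; apply; split => //; first exact: compact_closed hT cK.
  by rewrite setDv; exact: closed0.
have Qx : Q x by move=> C [].
have cQ : closed Q by apply: closed_bigI => C [].
apply: contrapT => /connectedPn[E [E0 QE sE]].
wlog Ex : E E0 QE sE / E false x => [W|].
  have [] : (E false `|` E true) x by rewrite -QE.
    exact: W.
  move=> Etx; apply: (W (fun b => E (~~ b))) => //=.
    by rewrite setUC.
  by rewrite separatedC.
have EQ b : E b `<=` Q by rewrite QE => y; case: b; [right|left].
have cE b : closed (E b).
  move=> y cy.
  have : Q y by rewrite (closure_id Q).1//; exact: closureS cy.
  rewrite QE; case: sE => s1 s2; case: b cy => cy [] // Ey.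
    by have : (E false `&` closure (E true)) y by []; rewrite s2.
  by have : (closure (E false) `&` E true) y by []; rewrite s1.
have kE b : compact (E b).
  by apply: subclosed_compact (cE b) cK _ => y /EQ /QK.
have [|O [oO EO OE]] := compact_separation (kE false) (kE true).
  exact: separated_disjoint.
have oO' : open (~` closure O) by exact/closed_openC/closed_closure.
have [|C KC CO] := quasi_component_sub cK Kx (openU oO oO').
  rewrite -/Q QE => y [/EO|Ey]; first by left.
  by right=> Oy; have : (closure O `&` E true) y by []; rewrite OE.
case: (KC) => CK cC cKC Cx.
(* C meets the frontier of O nowhere, so C & closure O = C & O is clopen. *)
have KCO : clopen_in K x (C `&` closure O).
  split; last by split => //; exact/subset_closure/EO.
  - by move=> y [/CK].
  - by apply: closedI => //; exact: closed_closure.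
  - have -> : K `\` (C `&` closure O) = (K `\` C) `|` (C `&` ~` O).
      apply/seteqP; split => y.
        move=> [Ky /not_andP nCO]; have [Cy|] := pselect (C y); last by left.
        by right; split => // Oy; case: nCO => //; apply; exact: subset_closure.
      move=> [[Ky nCy]|[Cy nOy]]; first by split => // -[].
      split; first exact: CK.
      by move=> [_ cOy]; have [/nOy|/(_ cOy)] := CO _ Cy.
    by apply: closedU => //; apply: closedI => //; exact: open_closedC.
have [y Ey] := E0 true; have [_ Oy] := EQ _ _ Ey _ KCO.
by have : (closure O `&` E true) y by []; rewrite OE.
Qed.

Hypothesis tdT : totally_disconnected [set: T].

Lemma compact_open_base (x : T) (U : set T) : nbhs x U ->
  exists V : set T, [/\ open V, compact V, V x & V `<=` U].
Proof.
move=> Ux; have [K cK Kx] := compact_nbhs x.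
have Q1 : \bigcap_(C in clopen_in K x) C `<=` (U `&` K)°.
  move=> y Qy; have : connected_component [set: T] x y.
    exists (\bigcap_(C in clopen_in K x) C) => //; split => //.
      by move=> C [].
    by apply: quasi_component_connected => //; exact: nbhs_singleton.
  by rewrite tdT // => -> ; exact: filterI.
have [C [CK cC cKC Cx] CU] :=
  quasi_component_sub cK (nbhs_singleton Kx) (@open_interior _ _) Q1.
exists C; split => //; last by move=> y /CU /interior_subset[].
  have -> : C = (U `&` K)° `&` ~` (K `\` C).
    apply/seteqP; split => y; first by move=> Cy; split; [exact: CU | case].
    move=> [/interior_subset[_ Ky] nKC]; apply: contrapT => nC.
    by apply: nKC.
  by apply: openI; [exact: open_interior | exact: closed_openC].
exact: subclosed_compact cC cK CK.
Qed.
End CompactOpen.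

(** * Continuity of *-homomorphisms *)

Section Limits.
Variables (R : realType) (V : completeNormedModType R[i]).

Lemma geometric_steps_cvg (u : nat -> V) (C q : R) : 0 <= q < 1 ->
  (forall n, `|u n.+1 - u n| <= (C * q ^+ n)%:C%C) -> exists l : V, u @ \oo --> l.
Proof.
move=> /andP[q0 q1] uC; have q1' : 0 < 1 - q by rewrite subr_gt0.
have dist n k : `|u (n + k)%N - u n| <= (C / (1 - q) * q ^+ n * (1 - q ^+ k))%:C%C.
  elim: k => [|k IHk]; first by rewrite addn0 subrr normr0 expr0 subrr mulr0.
  rewrite addnS -(subrKA (u (n + k)%N)).
  apply: le_trans (ler_normD _ _) _; apply: le_trans (lerD (uC _) IHk) _.
  rewrite -rmorphD lecR exprD exprS le_eqVlt; apply/orP; left; apply/eqP.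
  by field; rewrite gt_eqF.
have C0 : 0 <= C.
  by have := le_trans (normr_ge0 _) (uC 0%N); rewrite expr0 mulr1 ler0c.
suff : cvg (u @ \oo) by move=> /cvg_ex[l ul]; exists l.
apply: cauchy_cvg; apply: cauchy_exP => e e0.
have [N hN] : exists N, C / (1 - q) * q ^+ N < complex.Re e.
  have qn : `|q| < 1 by rewrite ger0_norm.
  have /cvgrPdist_lt/(_ (complex.Re e)) := cvg_geometric (C / (1 - q)) qn.
  rewrite -ltcR C_ge0_Re ?(ltW e0)// => /(_ e0)[N _ /(_ N (leqnn N))].
  by rewrite /= sub0r normrN => /(le_lt_trans (ler_norm _)); exists N.
exists (u N); exists N => // n /= Nn; rewrite -ball_normE /= distrC.
rewrite -(subnKC Nn); apply: le_lt_trans (dist _ _) _.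
rewrite -[e]C_ge0_Re ?(ltW e0)// ltcR; apply: le_lt_trans hN.
rewrite ler_piMr ?mulr_ge0 ?invr_ge0 ?exprn_ge0 ?(ltW q1')//.
by rewrite gerBl exprn_ge0.
Qed.
End Limits.

Lemma dist_le_continuous (K : numFieldType) (V W : normedModType K) (f : V -> W) :
  (forall x y, `|f x - f y| <= `|x - y|) -> continuous f.
Proof.
move=> fle x; apply/cvgrPdist_lt => e e0.
have : y @[y --> x] --> x by exact: cvg_id.
move=> /cvgrPdist_lt/(_ _ e0).
by apply: filterS => y; apply: le_lt_trans.
Qed.

Section CStarTheory.
Variables (R : realType) (A : cstarType R).
Implicit Types x y z s d : A.

Lemma starB x y : star (x - y) = star x - star y.
Proof. by rewrite starD -scaleN1r starZ rmorphN rmorph1 scaleN1r. Qed.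

Lemma star0 : star (0 : A) = 0.
Proof. by rewrite -[0 in LHS](subrr 0) starB subrr. Qed.

Lemma star_norm x : `|star x| = `|x|.
Proof.
have le y : `|y| <= `|star y|.
  have [->|y0] := eqVneq y 0; first by rewrite normr0.
  rewrite -(ler_pM2r (x := `|y|)) ?normr_gt0//.
  by rewrite -expr2 -cstar_id normM_le.
by apply/eqP; rewrite eq_le le -{2}[x]starK le.
Qed.

Lemma star_continuous : continuous (@star R A).
Proof. by apply: dist_le_continuous => x y; rewrite -starB star_norm. Qed.

Lemma cvg_mulg (T : Type) (F : set_system T) (FF : Filter F) (f g : T -> A) x y :
  f @ F --> x -> g @ F --> y -> (fun t => (f t * g t)%g) @ F --> (x * y)%g.
Proof.
move=> /cvgrPdist_lt fx /cvgrPdist_lt gy; apply/cvgrPdist_lt => e e0.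
pose c := `|x| + `|y| + 1 + e.
have c0 : 0 < c by rewrite ltr_wpDl// addr_ge0// addr_ge0.
have e'0 : 0 < e / c by rewrite divr_gt0.
have e'1 : e / c <= 1.
  by rewrite ler_pdivrMr// mul1r lerDr addr_ge0// addr_ge0.
apply: filterS2 (fx _ e'0) (gy _ e'0) => t {}fx {}gy.
have -> : (x * y)%g - (f t * g t)%g =
    (x * (y - g t)%R)%g + ((x - f t)%R * g t)%g.
  by rewrite rngBr rngBl addrA subrK.
apply: le_lt_trans (ler_normD _ _) _.
apply: (@le_lt_trans _ _ (`|x| * (e / c) + (e / c) * (`|y| + 1))).
  apply: lerD; apply: le_trans (normM_le _ _) _.
    by rewrite ler_wpM2l// ltW.
  apply: ler_pM => //; first exact: ltW.
  rewrite -[g t](subKr y); apply: le_trans (ler_normB _ _) _.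
  by rewrite lerD2l (le_trans (ltW gy)).
rewrite mulrC -mulrDr -mulrA gtr_pMr// mulrC ltr_pdivrMr// mul1r.
by rewrite /c addrA ltrDl.
Qed.

Lemma mulg_continuousl y : continuous (fun x : A => (x * y)%g).
Proof. by move=> x; apply: cvg_mulg; [exact: cvg_id | exact: cvg_cst]. Qed.

Lemma mulg_continuousr x : continuous (fun y : A => (x * y)%g).
Proof. by move=> y; apply: cvg_mulg; [exact: cvg_cst | exact: cvg_id]. Qed.

(** Both choices of [b], [i] and [- i], are used below. In the expansion of
    [(u x)^* (u x)] for [u = (1 - d) + b s] the cross terms cancel because [s] and
    [d] commute; the algebra may have no unit, hence the factor [x]. *)
Lemma norm_mul_sum_sqr1 s d x : star s = s -> star d = d ->
  (s * d = d * s)%g -> (s * s)%g = d + d - (d * d)%g ->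
  forall b : R[i], b^* = - b -> b ^+ 2 = -1 ->
  `|x - (d * x)%g + b *: (s * x)%g| = `|x|.
Proof.
move=> s_sa d_sa sd ss b bN b2; set w := x - (d * x)%g; set v := (s * x)%g.
apply/eqP; rewrite -(@eqrXn2 _ 2)// -!cstar_id; apply/eqP; congr (`|_|).
have ws : star w = star x - (star x * d)%g by rewrite starB starM d_sa.
have vs : star v = (star x * s)%g by rewrite starM s_sa.
have wv : (star w * v)%g = (star v * w)%g.
  by rewrite ws vs rngBl rngBr !mulgA -(mulgA _ s d) sd mulgA.
have wwvv : (star w * w)%g + (star v * v)%g = (star x * x)%g.
  rewrite ws vs rngBl !rngBr -!mulgA [(s * (s * x))%g]mulgA ss.
  rewrite rngBl rngDl rngBr rngDr -mulgA opprB.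
  by rewrite [X in X + _ = _]addrACA -opprD subrKA addrK.
clearbody w v; rewrite starD starZ bN scaleNr rngBl !rngDr scale_mull !scale_mulr.
rewrite scale_mull scalerA -expr2 b2 scaleN1r opprD opprK wv.
by rewrite addrA addrK.
Qed.

(** The hypothesis says that [s^2 + (1 - d)^2 = 1], so that [u = (1 - d) + i s]
    is unitary and [s] is its imaginary part. Thus [2 i s x = u x - u^* x] has norm
    at most [2 |x|], and [x := s] gives [|s|^2 <= |s|]. *)
Lemma sum_sqr1_norm_le1 s d : star s = s -> star d = d ->
  (s * d = d * s)%g -> (s * s)%g = d + d - (d * d)%g -> `|s| <= 1.
Proof.
move=> s_sa d_sa sd ss.
have iN : ('i : R[i])^* = - 'i by exact: conjCi.
have u1 := @norm_mul_sum_sqr1 s d s s_sa d_sa sd ss 'i iN (sqrCi _).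
have iN' : (- 'i : R[i])^* = - - 'i by rewrite rmorphN; congr (- _).
have i2 : (- 'i : R[i]) ^+ 2 = -1 by rewrite sqrrN sqrCi.
have u2 := @norm_mul_sum_sqr1 s d s s_sa d_sa sd ss (- 'i) iN' i2.
rewrite scaleNr in u2.
have : `|('i + 'i : R[i]) *: (s * s)%g| <= `|s| + `|s|.
  rewrite -{1}u1 -u2//; apply: le_trans (ler_normB _ _).
  by rewrite opprD opprK addrACA subrr add0r -scalerDl.
rewrite -mulr2n -[`|s| + _]mulr2n normrZ normrMn normCi mulr_natl.
rewrite ler_pMn2r// -[X in (X * _)%g]s_sa cstar_id.
have [->|s0] := eqVneq s 0; first by rewrite normr0.
by rewrite expr2 ger_pMr ?normr_gt0//.
Qed.

(** The element [d] is [1 - sqrt (1 - a^2)], obtained as the limit of the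
    iteration [c |-> (a^2 + c^2) / 2] from [0], which contracts the ball of radius
    [|a|] by the factor [|a|]. All iterates are self-adjoint and commute with
    [a]. *)
Lemma one_sub_sqrt a : star a = a -> `|a| < 1 ->
  exists d : A, [/\ star d = d, (a * d = d * a)%g & (a * a)%g = d + d - (d * d)%g].
Proof.
move=> a_sa a1; pose f (c : A) := 2^-1 *: ((a * a)%g + (c * c)%g).
pose u n := iter n f 0.
have half0 : 0 <= 2^-1 :> R[i] by rewrite invr_ge0.
have halfC : (2^-1 : R[i])^* = 2^-1 by rewrite conj_Creal// ger0_real.
have norm_half (x : A) : `|2^-1 *: x| = 2^-1 * `|x| by rewrite normrZ ger0_norm.
have u_norm n : `|u n| <= `|a|.
  elim: n => [|n IHn]; first by rewrite normr0.
  rewrite /= norm_half ler_pdivrMl// mulr_natl mulr2n.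
  apply: le_trans (ler_normD _ _) _; apply: lerD; apply: le_trans (normM_le _ _) _.
    by rewrite ler_piMl// ltW.
  by rewrite -[leRHS]mul1r ler_pM// (le_trans IHn)// ltW.
have u_sa n : star (u n) = u n.
  by elim: n => [|n IHn]; rewrite ?star0//= starZ halfC starD !starM IHn a_sa.
have u_comm n : (a * u n = u n * a)%g.
  elim: n => [|n IHn]; first by rewrite rng_mul0r rng_mulr0.
  rewrite [u n.+1]/(f (u n)) /f scale_mulr scale_mull rngDr rngDl.
  by rewrite !mulgA IHn -(mulgA (u n)) IHn mulgA.
have Rea : (complex.Re `|a|)%:C%C = `|a| by exact: C_ge0_Re.
have u_step n : `|u n.+1 - u n| <= `|a| ^+ n.
  elim: n => [|n IHn]; first by rewrite expr0 subr0 (le_trans (u_norm 1%N))// ltW.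
  rewrite [u n.+2]/(f (u n.+1)) [X in _ - X]/(f (u n)) /f -scalerBr norm_half.
  rewrite opprD addrACA subrr add0r ler_pdivrMl// mulr_natl mulr2n exprS.
  have -> : (u n.+1 * u n.+1)%g - (u n * u n)%g =
     (u n.+1 * (u n.+1 - u n)%R)%g + ((u n.+1 - u n)%R * u n)%g.
    by rewrite rngBr rngBl addrA subrK.
  apply: le_trans (ler_normD _ _) _; apply: lerD; apply: le_trans (normM_le _ _) _.
    by apply: ler_pM => //; exact: u_norm.
  by rewrite mulrC; apply: ler_pM => //; exact: u_norm.
have [|n|l ul] := @geometric_steps_cvg R A u 1 (complex.Re `|a|).
- by rewrite -lecR -ltcR Rea normr_ge0.
- by rewrite mul1r rmorphXn /= Rea; exact: u_step.
have hA : hausdorff_space A by exact: norm_hausdorff.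
have ull : (fun n => (u n * u n)%g) @ \oo --> (l * l)%g by exact: cvg_mulg.
exists l; split.
- apply: (cvg_unique _ _ ul) => //.
  have -> : u = @star R A \o u by apply/funext => n /=; rewrite u_sa.
  by apply: continuous_cvg => //; exact: star_continuous.
- have lu : (fun n => (a * u n)%g) @ \oo --> (a * l)%g.
    by apply: cvg_mulg => //; exact: cvg_cst.
  apply: (cvg_unique _ lu) => //.
  rewrite (_ : (fun n => _) = fun n => (u n * a)%g); last exact/funext.
  by apply: cvg_mulg => //; exact: cvg_cst.
- have ful : f \o u @ \oo --> f l by apply: cvgZr; apply: cvgD => //; exact: cvg_cst.
  have lf : l = f l.
    apply: (cvg_unique _ _ ful) => //.
    by move: ul; rewrite -cvg_shiftS.
  apply/eqP; rewrite eq_sym subr_eq {1 2}lf /f -scalerDl.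
  by rewrite -[2^-1]div1r -splitr scale1r.
Qed.
End CStarTheory.

Section StarHomTheory.
Variables (R : realType) (A B : cstarType R) (f : {starhom A -> B}).

(** The equation [a^2 + (1 - d)^2 = 1], solvable when [a] is self-adjoint with
    [|a| < 1], is preserved by [f] and bounds [f a] in the target. Scaling and the
    C*-identity extend the bound to all elements. *)
Lemma starhom_norm (x : A) : `|f x| <= `|x|.
Proof.
have sa_lt1 (a : A) : star a = a -> `|a| < 1 -> `|f a| <= 1.
  move=> a_sa /(one_sub_sqrt a_sa)[d [d_sa ad aa]].
  apply: (@sum_sqr1_norm_le1 _ _ (f a) (f d)).
  - by rewrite -starhom_star a_sa.
  - by rewrite -starhom_star d_sa.
  - by rewrite -!gmulfM ad.
  - by have := congr1 f aa; rewrite raddfB raddfD !gmulfM.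
have sa (a : A) : star a = a -> `|f a| <= `|a|.
  move=> a_sa; apply/ler_addgt0Pr => e e0.
  have M0 : 0 < `|a| + e by rewrite ltr_wpDl.
  have MV : `|(`|a| + e)^-1| = (`|a| + e)^-1 by rewrite ger0_norm// invr_ge0 ltW.
  have := @sa_lt1 ((`|a| + e)^-1 *: a).
  rewrite linearZ !normrZ MV !ler_pdivrMl// ltr_pdivrMl// mulr1; apply.
    by rewrite starZ a_sa conj_Creal// ger0_real// invr_ge0 ltW.
  by rewrite ltrDl.
rewrite -(@ler_pXn2r _ 2)// ?nnegrE//.
by rewrite -!cstar_id -starhom_star -gmulfM sa// starM starK.
Qed.

Lemma starhom_continuous : continuous f.
Proof. by apply: dist_le_continuous => x y; rewrite -raddfB starhom_norm. Qed.
End StarHomTheory.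

(** * Combinations of orthogonal projections *)

Section OrthogonalIdempotents.
Variable A : rngType.
Implicit Types (x y e : A).

Lemma rng_suml (I : finType) (F : I -> A) x :
  ((\sum_i F i)%R * x)%g = \sum_i (F i * x)%g.
Proof.
by apply: (big_morph (fun y => (y * x)%g)) => [y z|]; [exact: rngDl | exact: rng_mul0r].
Qed.

Lemma rng_sumr (I : finType) (F : I -> A) x :
  (x * (\sum_i F i)%R)%g = \sum_i (x * F i)%g.
Proof.
by apply: (big_morph (fun y => (x * y)%g)) => [y z|]; [exact: rngDr | exact: rng_mulr0].
Qed.

Definition orthogonal_idempotents (I : finType) (p : I -> A) : Prop :=
  forall i j, (p i * p j)%g = if i == j then p i else 0.

(** Adding an idempotent [e] to an orthogonal family splits each [p i] into its
    parts inside and outside [e], and adds what [e] has outside all [p i]. *)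
Lemma orthogonal_refine (I : finType) (p : I -> A) (e : A) :
  (forall i, (p i * e)%g = (e * p i)%g) -> (e * e)%g = e ->
  orthogonal_idempotents p ->
  orthogonal_idempotents (fun k : I + I + unit => match k with
    | inl (inl i) => (p i * e)%g
    | inl (inr i) => p i - (p i * e)%g
    | inr _ => e - \sum_i (p i * e)%g
    end).
Proof.
move=> pe ee op.
have pp i j : ((p i * e) * (p j * e))%g = if i == j then (p i * e)%g else 0.
  rewrite mulgA -(mulgA (p i)) -pe mulgA op; case: eqP => _.
    by rewrite -mulgA ee.
  by rewrite !rng_mul0r.
have ep i j : ((p i * e) * p j)%g = if i == j then (p i * e)%g else 0.
  by rewrite -mulgA -pe mulgA op; case: eqP => _; rewrite ?rng_mul0r.
have pep i j : (p i * (p j * e))%g = if i == j then (p i * e)%g else 0.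
  by rewrite mulgA op; case: eqP => _; rewrite ?rng_mul0r.
have pq i : (p i * (e - \sum_j (p j * e)%g)%R)%g = 0.
  rewrite rngBr rng_sumr (bigD1 i)//= pep eqxx big1 ?addr0 ?subrr// => j ji.
  by rewrite pep eq_sym (negbTE ji).
have peq i : (p i * e * (e - \sum_j (p j * e)%g)%R)%g = 0.
  rewrite rngBr rng_sumr -mulgA ee (bigD1 i)//= pp eqxx big1 ?addr0 ?subrr// => j ji.
  by rewrite pp eq_sym (negbTE ji).
have qe : ((e - \sum_j (p j * e)%g)%R * e)%g = e - \sum_j (p j * e)%g.
  rewrite rngBl rng_suml ee; congr (_ - _); apply: eq_bigr => j _.
  by rewrite -mulgA ee.
have qp i : ((e - \sum_j (p j * e)%g)%R * p i)%g = 0.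
  rewrite rngBl rng_suml (bigD1 i)//= ep eqxx big1 ?addr0 -?pe ?subrr// => j ji.
  by rewrite ep (negbTE ji).
case=> [[i|i]|[]] [[j|j]|[]] /=; rewrite ?eqxx.
- by rewrite pp.
- by rewrite rngBr ep pp subrr.
- exact: peq.
- by rewrite rngBl pep pp subrr.
- rewrite rngBl !rngBr op pep ep pp subrr subr0.
  rewrite -[RHS]/(if i == j then p i - (p i * e)%g else 0).
  by case: eqP => _; rewrite ?subrr.
- by rewrite rngBl pq peq subrr.
- by rewrite mulgA qp rng_mul0r.
- by rewrite rngBr mulgA qp rng_mul0r subrr.
- rewrite rngBr qe [X in _ - X](_ : _ = 0) ?subr0// rng_sumr big1// => i _.
  by rewrite mulgA qp rng_mul0r.
Qed.
End OrthogonalIdempotents.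

Inductive lspan (K : pzRingType) (V : lmodType K) (P : set V) : V -> Prop :=
| lspan0 : lspan P 0
| lspan_step a x y : P x -> lspan P y -> lspan P (a *: x + y).

Section LinearSpan.
Variables (K : pzRingType) (V : lmodType K) (P : set V).

Lemma lspanD x y : lspan P x -> lspan P y -> lspan P (x + y).
Proof.
move=> Px Py; elim: Px => [|a p z Pp _ IHz]; first by rewrite add0r.
by rewrite -addrA; exact: lspan_step.
Qed.

Lemma lspanZ a x : lspan P x -> lspan P (a *: x).
Proof.
elim=> [|b p y Pp _ IHy]; first by rewrite scaler0; exact: lspan0.
by rewrite scalerDr scalerA; exact: lspan_step.
Qed.

Lemma lspanB x y : lspan P x -> lspan P y -> lspan P (x - y).
Proof. by move=> Px Py; rewrite -scaleN1r; apply/lspanD/lspanZ. Qed.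

Lemma lspan_gen x : P x -> lspan P x.
Proof.
by move=> Px; rewrite -[x]addr0 -[x]scale1r; apply: lspan_step => //; exact: lspan0.
Qed.

Lemma lspan_sum (I : finType) (F : I -> V) :
  (forall i, lspan P (F i)) -> lspan P (\sum_i F i).
Proof.
by move=> PF; apply: big_ind => // [|x y]; [exact: lspan0 | exact: lspanD].
Qed.
End LinearSpan.

Lemma lspan_orthogonal (K : pzRingType) (A : rngType) (V : lmodType K)
    (f : {additive A -> V}) (z : V) :
  commutative (fun x y : A => (x * y)%g) ->
  lspan (f @` [set e | (e * e)%g = e]) z ->
  exists (I : finType) (p : I -> A) (a : I -> K),
    orthogonal_idempotents p /\ z = \sum_i a i *: f (p i).
Proof.
move=> mC; elim=> [|b _ y [e ee <-] _ [I [p [a [op ->]]]]].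
  by exists void, (fun=> 0), (fun=> 0); split; [case | rewrite big_pred0// => -[]].
exists (I + I + unit)%type; eexists; exists (fun k => match k with
  | inl (inl i) => a i + b | inl (inr i) => a i | inr _ => b end).
split; first exact: (orthogonal_refine (e := e) _ ee op).
rewrite !big_sumType /= [X in _ = _ + X](big_pred1 tt) => [|[]//].
rewrite raddfB raddf_sum /= scalerBr scaler_sumr.
under [X in _ = X + _ + _]eq_bigr do rewrite scalerDl.
under [X in _ = _ + X + _]eq_bigr do rewrite raddfB scalerBr.
rewrite big_split sumrB /=.
by rewrite [X in _ = X + _]addrC subrKA addrACA subrr addr0 addrC.
Qed.

Section OrthogonalProjections.
Variables (R : realType) (A : cstarType R) (I : finType) (p : I -> A).
Hypothesis op : orthogonal_idempotents p.
Implicit Types a b : I -> R[i].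

Lemma orthogonal_sumM a b :
  ((\sum_i a i *: p i)%R * (\sum_i b i *: p i)%R)%g = \sum_i (a i * b i) *: p i.
Proof.
rewrite rng_suml; apply: eq_bigr => i _; rewrite rng_sumr (bigD1 i)//=.
rewrite scale_mull scale_mulr scalerA op eqxx big1 ?addr0// => j ji.
by rewrite scale_mull scale_mulr op eq_sym (negbTE ji) !scaler0.
Qed.

(** Multiplication by [p j] turns the sum into [a j *: p j]. *)
Lemma orthogonal_sum_ge a j : p j != 0 -> `|a j| <= `|\sum_i a i *: p i|.
Proof.
move=> pj; rewrite -(ler_pM2r (x := `|p j|)) ?normr_gt0// -normrZ.
apply: le_trans (normM_le _ _); rewrite rng_suml (bigD1 j)//= big1 ?addr0 => [|i ij].
  by rewrite scale_mull op eqxx.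
by rewrite scale_mull op (negbTE ij) scaler0.
Qed.

Hypothesis p_sa : forall i, star (p i) = p i.

Lemma star_orthogonal_sum a : star (\sum_i a i *: p i) = \sum_i (a i)^* *: p i.
Proof.
rewrite (big_morph _ (@starD R A) (@star0 R A)).
by apply: eq_bigr => i _; rewrite starZ p_sa.
Qed.

(** After division by [M] and passage to absolute values the coefficients [t i]
    lie in [[0, 1]], and with [c i = 1 - sqrt (1 - t i ^ 2)] the two sums satisfy
    the hypotheses of [sum_sqr1_norm_le1]. *)
Lemma orthogonal_sum_le a (M : R[i]) : 0 <= M -> (forall i, `|a i| <= M) ->
  `|\sum_i a i *: p i| <= M.
Proof.
rewrite le_eqVlt => /predU1P[<- a0|M0 aM].
  by rewrite big1 ?normr0// => i _; have := a0 i; rewrite normr_le0 => /eqP ->; rewrite scale0r.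
pose t i := `|a i| / M; pose c i := 1 - sqrtC (1 - t i ^+ 2).
have t0 i : 0 <= t i by rewrite divr_ge0// ltW.
have t1 i : 0 <= 1 - t i ^+ 2.
  by rewrite subr_ge0 expr_le1// /t ler_pdivrMr// mul1r.
have tC i : (t i)^* = t i by rewrite conj_Creal// ger0_real.
have cC i : (c i)^* = c i.
  by rewrite conj_Creal// realB// ger0_real// sqrtC_ge0.
have s1 : `|\sum_i t i *: p i| <= 1.
  apply: (@sum_sqr1_norm_le1 _ _ _ (\sum_i c i *: p i)).
  - by rewrite star_orthogonal_sum; apply: eq_bigr => i _; rewrite tC.
  - by rewrite star_orthogonal_sum; apply: eq_bigr => i _; rewrite cC.
  - by rewrite !orthogonal_sumM; apply: eq_bigr => i _; rewrite mulrC.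
  rewrite !orthogonal_sumM -big_split -sumrB; apply: eq_bigr => i _ /=.
  rewrite -scalerDl -scalerBl; congr (_ *: _).
  have := sqrtCK (1 - t i ^+ 2); rewrite /c; move: (sqrtC _) => r.
  by rewrite expr2 => r2; ring: r2.
rewrite -(@ler_pXn2r _ 2)// ?nnegrE ?(ltW M0)// -cstar_id star_orthogonal_sum.
rewrite orthogonal_sumM.
have -> : \sum_i ((a i)^* * a i) *: p i = M ^+ 2 *: \sum_i (t i * t i) *: p i.
  rewrite scaler_sumr; apply: eq_bigr => i _; rewrite scalerA; congr (_ *: _).
  rewrite mulrC -normCK /t; field; by rewrite gt_eqF.
rewrite -orthogonal_sumM normrZ ger0_norm ?exprn_ge0 ?(ltW M0)//.
rewrite ler_piMr ?exprn_ge0 ?(ltW M0)//; apply: le_trans (normM_le _ _) _.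
by rewrite mulr_ile1.
Qed.
End OrthogonalProjections.

(** * Faithfulness of Z_0[E] in C*_u(E) *)

Section Evaluation.
Variables (R : realType) (T : topologicalType) (x : T).

Definition C0_eval (f : C0 R T) : R[i] := f x.

Fact C0_eval_is_zmod_morphism : zmod_morphism C0_eval. Proof. by []. Qed.
HB.instance Definition _ :=
  GRing.isZmodMorphism.Build (C0 R T) R[i] C0_eval C0_eval_is_zmod_morphism.
End Evaluation.

Section Injectivity.
Variable E : semilatticeType.

Lemma Z0_mulC : commutative (fun x y : Z0 E => (x * y)%g).
Proof.
elim/Z0_ind=> D1; elim/Z0_ind=> D2.
by rewrite -![(_ * _)%g]/(Z0_mul _ _) !Z0_mulE ZE_mulC.
Qed.

Lemma Z0_sumE (D : {freeg E / int}) :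
  \pi_(Z0 E) D = \sum_(e <- dom D) z0 e *~ coeff e D.
Proof.
rewrite -{1}(freeg_sumE D) raddf_sum; apply: eq_bigr => e _.
by rewrite -[X in << X *g _ >>]intz -freegU_mulz raddfMz.
Qed.

(** The character attached to [d] is the indicator of the elements above [d].
    Induction on the number of elements of the support above [d] shows that all
    coefficients strictly above [d] vanish, which leaves that of [d] itself. *)
Lemma semilattice_character_free (K : numDomainType) (D : {freeg E / int}) :
  (forall d : E, d != slzero ->
    \sum_(e <- dom D) ((d * e)%g == d)%:R *~ coeff e D = 0 :> K) ->
  forall d : E, d != slzero -> coeff d D = 0.
Proof.
move=> D0 d; have [n] := ubnP (count (fun e => (d * e)%g == d) (dom D)).
elim: n => // n IHn in d * => dn d0.
have [dD|/coeff_outdom//] := boolP (d \in dom D).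
have := D0 d d0; rewrite (bigD1_seq d)//= ?uniq_dom// mulss eqxx.
rewrite big1_seq ?addr0 => [/eqP|e /andP[ed eD]]; first by rewrite intr_eq0 => /eqP.
have [de|] := eqVneq (d * e)%g d; last by rewrite mul0rz.
have e0 : e != slzero.
  by apply: contraNneq d0 => e0; rewrite -de e0 mulsC mul0s.
rewrite IHn ?mulr0z//; rewrite ltnS in dn; apply: leq_trans dn.
have up f : (e * f)%g == e -> (d * f)%g == d.
  by move=> /eqP ef; rewrite -{1}de -mulgA ef de.
rewrite -(addn1 (count _ _)).
have d1 : (0 < count (pred1 d) (dom D))%N by rewrite -has_count has_pred1.
apply: leq_trans (leq_add (leqnn _) d1) _.
rewrite -count_predUI [X in (_ + X)%N](_ : _ = 0%N) ?addn0.
  apply: sub_count => f /= /orP[/up//|/eqP ->]; by rewrite mulss.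
apply/eqP; rewrite -leqn0 leqNgt -has_count; apply/hasPn => f _ /=.
apply/negP => /andP[/eqP ef /eqP fd]; move: ed; rewrite -ef fd mulsC de.
by rewrite eqxx.
Qed.

Variables (R : realType) (U : universal_cstar R E).

HB.instance Definition _ :=
  GRing.isZmodMorphism.Build (Z0 E) U (Cu_span U) (Cu_spanB U).

(** The complex numbers enter as the C*-algebra of functions on a point. *)
Local Notation pt := (discrete_topology unit).

Fact const_C0_subproof (c : R[i]) : (fun=> c : R[i]^o) \in @C0_pred R pt.
Proof.
apply/C0_predP; split; first exact: cst_continuous.
move=> e e0; exists setT => [|x /(_ I)//].
rewrite (_ : setT = [set tt]); first exact: compact_set1.
by apply/seteqP; split=> -[].
Qed.
Definition const_C0 (c : R[i]) : C0 R pt := MkC0 (const_C0_subproof c).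

Lemma character_family (d : E) : d != slzero ->
  projection_family (fun e => const_C0 ((d * e)%g == d)%:R).
Proof.
move=> d0; split=> [e||e f].
- split; apply: C0_eq => x /=; first by rewrite rmorph_nat.
  by rewrite -natrM mulnb andbb.
- by apply: C0_eq => x /=; rewrite mulsC mul0s eq_sym (negbTE d0).
- apply: C0_eq => x /=; rewrite -natrM mulnb; congr ((nat_of_bool _)%:R).
  apply/eqP/andP => [def|[/eqP de /eqP df]]; last by rewrite mulgA de.
  split; apply/eqP; rewrite -{1}def.
    by rewrite (mulsC e) mulgA -(mulgA _ e) mulss -mulgA (mulsC f).
  by rewrite -!mulgA mulss.
Qed.

Lemma Cu_span_inj : injective (Cu_span U).
Proof.
apply: raddf_inj => x; rewrite -[x]reprK; move: (repr x) => D D0.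
have coeff0 : forall d : E, d != slzero -> coeff d D = 0.
  apply: (@semilattice_character_free R[i]) => d d0.
  pose f := Cu_lift U (character_family d0).
  have := congr1 (fun h => C0_eval (tt : pt) (f h)) D0.
  rewrite /= raddf0 Z0_sumE !raddf_sum raddf0; apply: etrans.
  by apply: eq_bigr => e _; rewrite !raddfMz /= Cu_spanE Cu_liftE.
rewrite Z0_sumE big1_seq// => e /andP[_ _].
have [->|/coeff0 ->] := eqVneq e slzero; last by rewrite mulr0z.
by rewrite z00 mul0rz.
Qed.
End Injectivity.

(** * The span of the generating projections *)

Lemma closure_map (T T' : topologicalType) (f : T -> T')
    (P : set T) (Q : set T') : continuous f ->
  (forall x, P x -> closure Q (f x)) -> forall x, closure P x -> closure Q (f x).
Proof.
move=> cf PQ x Px.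
have clQ : closed (f @^-1` closure Q).
  by apply: preimage_closed; [move=> ? _; exact: cf | exact: closed_closure].
exact: clQ (closure_subset PQ Px).
Qed.

Section ProjectionSpan.
Variables (R : realType) (E : semilatticeType) (U : universal_cstar R E).

Definition proj_span : set U := lspan (range (Cu_proj U)).

Lemma proj_span_Cu_span x : proj_span (Cu_span U x).
Proof.
elim/Z0_gen_ind: x => [e|x y Dx Dy|].
- by rewrite Cu_spanE; apply: lspan_gen; exists e.
- by rewrite raddfB; exact: lspanB.
- by rewrite raddf0; exact: lspan0.
Qed.

Lemma proj_span_idempotents z : proj_span z ->
  lspan (Cu_span U @` [set r | (r * r)%g = r]) z.
Proof.
elim=> [|a _ y [e _ <-] _ IHy]; first exact: lspan0.
apply: lspan_step IHy; exists (z0 e); last by rewrite Cu_spanE.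
by rewrite /= -z0M mulss.
Qed.

Lemma proj_spanM x y : proj_span x -> proj_span y -> proj_span (x * y)%g.
Proof.
move=> Dx Dy; elim: Dx => [|a _ z [d _ <-] _ IHz].
  by rewrite rng_mul0r; exact: lspan0.
rewrite rngDl scale_mull; apply: lspanD => //; apply: lspanZ.
elim: Dy => [|b _ w [e _ <-] _ IHw]; first by rewrite rng_mulr0; exact: lspan0.
rewrite rngDr scale_mulr; apply: lspan_step => //; exists (d * e)%g => //.
exact: pfM (Cu_family U) d e.
Qed.

Lemma proj_span_star x : proj_span x -> proj_span (star x).
Proof.
elim=> [|a _ z [d _ <-] _ IHz]; first by rewrite star0; exact: lspan0.
rewrite starD starZ; apply: lspan_step => //; exists d => //.
by have [-> _] := pf_proj (Cu_family U) d.
Qed.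

Lemma closure_proj_span_subalgebra : cstar_subalgebra (closure proj_span).
Proof.
have addc (y : U) : continuous (fun x => x + y).
  by apply: dist_le_continuous => x z; rewrite opprD addrACA subrr addr0.
have scalec (a : R[i]) : continuous (fun x : U => a *: x).
  by move=> x; apply: cvgZr; exact: cvg_id.
split.
- exact: closed_closure.
- exact/subset_closure/lspan0.
- move=> x y Dx Dy; apply: (closure_map (f := fun x => x + y) _ _ Dx) => // z Dz.
  rewrite addrC; apply: (closure_map (f := fun x => x + z) _ _ Dy) => // t Dt.
  exact/subset_closure/lspanD.
- move=> a x; apply: closure_map => // z Dz; exact/subset_closure/lspanZ.
- move=> x y Dx Dy.
  apply: (closure_map (f := fun x => (x * y)%g) _ _ Dx) => [|z Dz].
    exact: mulg_continuousl.
  apply: (closure_map (f := fun y => (z * y)%g) _ _ Dy) => [|t Dt].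
    exact: mulg_continuousr.
  exact/subset_closure/proj_spanM.
- move=> x; apply: closure_map; first exact: star_continuous.
  move=> z Dz; exact/subset_closure/proj_span_star.
Qed.

Lemma proj_span_dense x (e : R[i]) : 0 < e ->
  exists2 z, proj_span z & `|x - z| < e.
Proof.
move=> e0; have /seteqP[_ /(_ x I) Dx] : closure proj_span = setT.
  apply: Cu_generated closure_proj_span_subalgebra _ => d.
  by apply/subset_closure/lspan_gen; exists d.
have [z [Dz xz]] := Dx _ (nbhsx_ballx x _ e0).
by exists z => //; move: xz; rewrite -ball_normE.
Qed.

Variables (B : cstarType R) (f : {starhom U -> B}).

(** Write [z] as a combination of orthogonal idempotents of Z_0[E] and let [y]
    collect the terms killed by [f]. The coefficients of [z - y] are then among
    those of [f z] at nonzero projections. *)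
Lemma proj_span_trim z : proj_span z ->
  exists2 y, lspan (Cu_span U @` [set r | f (Cu_span U r) = 0]) y &
             `|z - y| <= `|f z|.
Proof.
move=> /proj_span_idempotents /(lspan_orthogonal (@Z0_mulC E)).
move=> [I [p [a [op zE]]]].
pose q i := Cu_span U (p i).
have oq : orthogonal_idempotents q.
  by move=> i j; rewrite -Cu_spanM op; case: eqP => // _; rewrite raddf0.
have ofq : orthogonal_idempotents (f \o q).
  move=> i j; have := congr1 f (oq i j); rewrite gmulfM => ->.
  by case: eqP => // _; rewrite raddf0.
exists (\sum_i (if f (q i) == 0 then a i else 0) *: q i).
  apply: lspan_sum => i; case: eqP => [fq|_]; last by rewrite scale0r; exact: lspan0.
  by apply/lspanZ/lspan_gen; exists (p i).
rewrite {1}zE -sumrB.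
under eq_bigr do rewrite -scalerBl.
have fz : f z = \sum_i a i *: (f \o q) i.
  by rewrite zE linear_sum; apply: eq_bigr => i _; rewrite linearZ.
apply: (orthogonal_sum_le oq) => [i||i]; first exact: Cu_span_star.
  exact: normr_ge0.
case: eqP => [_|/eqP fq]; first by rewrite subrr normr0 normr_ge0.
by rewrite subr0 fz; exact: orthogonal_sum_ge.
Qed.

(** Choose [w n] with [f (w n)] tending geometrically to [y], and replace each
    difference [w n.+1 - w n] by a lift [v n] of its image whose norm does not
    exceed that of the image; the sums of the [v n] converge to a preimage. *)
Lemma starhom_range_closed (y : B) :
  (forall e : R[i], 0 < e -> exists2 w, proj_span w & `|y - f w| < e) ->
  exists x, f x = y.
Proof.
move=> yf.
have half_gt0 n : 0 < (2^-1 ^+ n)%:C%C :> R[i] by rewrite ltcR exprn_gt0// invr_gt0.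
have /choice[w wP] n : exists w, proj_span w /\ `|y - f w| < (2^-1 ^+ n)%:C%C.
  by have [w Dw yw] := yf _ (half_gt0 n); exists w.
have /choice[v vP] n : exists v, f v = f (w n.+1 - w n) /\
    `|v| <= `|f (w n.+1 - w n)|.
  have [r rker rle] := proj_span_trim (lspanB (wP n.+1).1 (wP n).1).
  exists (w n.+1 - w n - r); split=> //; rewrite raddfB /=.
  suff -> : f r = 0 by rewrite subr0.
  elim: rker => [|a _ x [r' fr' <-] _ IHx]; first by rewrite raddf0.
  by rewrite linearD linearZ /= fr' scaler0 add0r.
pose u n := w 0%N + \sum_(i < n) v i.
have fu n : f (u n) = f (w n).
  elim: n => [|n IHn]; first by rewrite /u big_ord0 addr0.
  rewrite /u big_ord_recr /= addrA -/(u n) raddfD /= IHn (vP n).1 raddfB /=.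
  by rewrite addrC subrK.
have half01 : 0 <= (2^-1 : R) < 1 by rewrite invr_ge0 ler0n invf_lt1// ltr1n.
have [n|x ux] := @geometric_steps_cvg R U u 2 2^-1 half01.
  rewrite {1}/u big_ord_recr /= addrA -/(u n) addrAC subrr add0r.
  apply: le_trans (vP n).2 _.
  have -> : f (w n.+1 - w n) = (y - f (w n)) - (y - f (w n.+1)).
    by rewrite opprB [RHS]addrC subrKA raddfB.
  apply: le_trans (ler_normB _ _) _.
  rewrite mulr_natl mulr2n rmorphD; apply: lerD; first exact: ltW (wP n).2.
  apply: le_trans (ltW (wP n.+1).2) _; rewrite lecR exprS ler_piMl//.
    by rewrite exprn_ge0// invr_ge0.
  by case/andP: half01 => _ /ltW.
exists x; have hB : hausdorff_space B by exact: norm_hausdorff.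
have fux : f \o u @ \oo --> f x.
  by apply: continuous_cvg => //; exact: starhom_continuous.
apply: (cvg_unique _ fux) => //; apply/cvgrPdist_lt => e e0.
have half1 : `|2^-1 : R| < 1 by case/andP: half01 => ? ?; rewrite ger0_norm.
have /cvgrPdist_lt/(_ (complex.Re e)) := @cvg_geometric R 1 _ half1.
rewrite -ltcR C_ge0_Re ?(ltW e0)// => /(_ e0); apply: filterS => n /=.
rewrite sub0r normrN mul1r fu => /(le_lt_trans (ler_norm _)) ne.
by apply: lt_trans (wP n).2 _; rewrite -[e]C_ge0_Re ?(ltW e0)// ltcR.
Qed.
End ProjectionSpan.

(** * Density of locally constant functions *)

Section LocallyConstantDense.
Variables (R : realType) (T : topologicalType).
Hypotheses (hT : hausdorff_space T) (lcT : locally_compact [set: T]).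
Hypothesis tdT : totally_disconnected [set: T].

Fact C0Z_indic_subproof (V : set T) : open V -> compact V ->
  (fun x => (x \in V)%:Z) \in @C0Z_pred T.
Proof.
move=> oV cV; apply/C0Z_predP; split.
  apply/continuous_discreteP => x; have [Vx|Vx] := pselect (V x).
    have : nbhs x V by exact: open_nbhs_nbhs.
    by apply: filterS => y Vy; rewrite !mem_set.
  have : nbhs x (~` V).
    by apply: open_nbhs_nbhs; split => //; exact/closed_openC/(compact_closed hT).
  by apply: filterS => y Vy; rewrite !memNset.
by move=> e e0; exists V => // x Vx; rewrite memNset// normr0.
Qed.
Definition C0Z_indic (V : set T) (oV : open V) (cV : compact V) : C0Z T :=
  MkC0Z (C0Z_indic_subproof oV cV).

Definition locally_constant_span : set (C0 R T) := lspan (range (@C0Z_C0 T R)).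

Lemma locally_constant_spanM f g : locally_constant_span f ->
  locally_constant_span g -> locally_constant_span (f * g)%g.
Proof.
move=> Sf Sg; elim: Sf => [|a _ f' [h _ <-] _ IHf].
  by rewrite rng_mul0r; exact: lspan0.
rewrite rngDl scale_mull; apply: lspanD => //; apply: lspanZ.
elim: Sg => [|b _ g' [k _ <-] _ IHg]; first by rewrite rng_mulr0; exact: lspan0.
rewrite rngDr scale_mulr; apply: lspan_step => //; exists (h * k)%g => //.
by apply: C0_eq => x; exact: intrM.
Qed.

(** Call [W] good if it is compact open and some locally constant function
    approximates [f] on [W] and vanishes outside. Every point has a good
    neighbourhood and good sets are stable under union, so a compact set off which
    [f] is small is contained in a good set. *)
Lemma locally_constant_dense (f : C0 R T) (e : R[i]) : 0 < e ->
  exists2 g, locally_constant_span g & `|f - g| < e.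
Proof.
move=> e0; have e20 : 0 < e / 2 by rewrite divr_gt0.
pose good (W : set T) := [/\ open W, compact W & exists2 g, locally_constant_span g &
  forall y, (W y -> `|f y - g y| < e / 2) /\ (~ W y -> g y = 0)].
have good0 : good set0.
  split; [exact: open0 | exact: compact0 |].
  by exists 0; [exact: lspan0 | move=> y; split].
have goodU W W' : good W -> good W' -> good (W `|` W').
  move=> [oW cW [g Sg gW]] [oW' cW' [g' Sg' gW']]; split.
  - exact: openU.
  - exact: compactU.
  pose w := C0Z_C0 R (C0Z_indic oW cW).
  have Sw : locally_constant_span w by apply: lspan_gen; exists (C0Z_indic oW cW).
  (* This function is g on W and g' elsewhere. *)
  exists (g' + ((g - g')%R * w)%g).
    by apply: lspanD => //; apply: locally_constant_spanM => //; exact: lspanB.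
  move=> y; have -> : (g' + ((g - g')%R * w)%g) y = g' y + (g y - g' y) * (y \in W)%:Z%:~R.
    by [].
  have [Wy|Wy] := pselect (W y).
    rewrite mem_set// mulr1 [g' y + _]addrC subrK; split=> [_|]; first exact: (gW y).1.
    by move=> nWy; case: nWy; left.
  rewrite memNset// mulr0 addr0; split=> [[]//|].
    exact: (gW' y).1.
  by move=> nW'y; apply: (gW' y).2 => W'y; apply: nW'y; right.
have good_nbhs (x : T) : exists2 W, good W & nbhs x W.
  have /cvgrPdist_lt/(_ _ e20) fx := (C0P f).1 x.
  have [V [oV cV Vx Vf]] := compact_open_base hT lcT tdT fx.
  exists V; last exact: open_nbhs_nbhs.
  split=> //; pose v := C0Z_C0 R (C0Z_indic oV cV).
  exists (f x *: v); first by apply/lspanZ/lspan_gen; exists (C0Z_indic oV cV).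
  move=> y; have -> : (f x *: v) y = f x * (y \in V)%:Z%:~R by [].
  split=> Vy; last by rewrite memNset// mulr0.
  by rewrite mem_set// mulr1 distrC; exact: Vf.
have [K cK fK] := (C0P f).2 _ e20.
have [W [_ _ [g Sg gW]] KW] : exists2 W, good W & K `<=` W.
  apply: contrapT => nW; pose F := filter_from good (fun W => K `\` W).
  have FF : ProperFilter F.
    apply: filter_from_proper; last first.
      move=> W gW; apply/set0P/negP => /eqP; rewrite setD_eq0 => KW; apply: nW.
      by exists W.
    apply: filter_from_filter; first by exists set0.
    move=> W W' gW gW'; exists (W `|` W'); first exact: goodU.
    by rewrite setDUr.
  have FK : F K by exists set0 => // y [].
  have [p [Kp clp]] := cK F FF FK.
  have [W gW Wp] := good_nbhs p.
  have FW : F (K `\` W) by exists W.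
  by have [y [[_ +] Wy]] := clp _ _ FW Wp.
exists g => //; apply: le_lt_trans (_ : e / 2 < e); last first.
  by rewrite ltr_pdivrMr// ltr_pMr// ltr1n.
apply: C0_norm_le => [|y]; first exact: ltW.
have [Wy|Wy] := pselect (W y); first by apply/ltW; exact: (gW y).1.
rewrite -[(f - g) y]/(C0_eval y (f - g)) raddfB /= /C0_eval (gW y).2// subr0.
by apply/ltW/fK => /KW.
Qed.
End LocallyConstantDense.

(** * Exactness of the induced sequence *)

Section StarHomConstructions.
Variables (R : realType) (A B C : cstarType R).
Variables (f : {starhom A -> B}) (g : {starhom B -> C}).

Fact comp_starhom_star : {morph g \o f : x / star x}.
Proof. by move=> x; rewrite /= !starhom_star. Qed.
HB.instance Definition _ := isStarMorphism.Build R A C (g \o f) comp_starhom_star.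
End StarHomConstructions.

Section C0Action.
Variables (R : realType) (G : groupType) (Omega : td_system G) (g : G).

Fact C0_act_linear : linear (@C0_act R G Omega g).
Proof. by move=> a f h; exact: C0_eq. Qed.
HB.instance Definition _ := GRing.isLinear.Build R[i] (C0 R Omega) (C0 R Omega) *:%R
  (C0_act g) C0_act_linear.

Fact C0_actM : {morph (@C0_act R G Omega g) : f h / (f * h)%g}.
Proof. by move=> f h; exact: C0_eq. Qed.
HB.instance Definition _ := isMultiplicative.Build (C0 R Omega) (C0 R Omega)
  (C0_act g) C0_actM.

Fact C0_act_star : {morph (@C0_act R G Omega g) : f / star f}.
Proof. by move=> f; exact: C0_eq. Qed.
HB.instance Definition _ := isStarMorphism.Build R (C0 R Omega) (C0 R Omega)
  (C0_act g) C0_act_star.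
End C0Action.

Section StarHomsOnUniversal.
Variables (R : realType) (E : semilatticeType) (U : universal_cstar R E).
Variable B : cstarType R.

Lemma starhom_eq (f f' : {starhom U -> B}) :
  (forall e, f (Cu_proj U e) = f' (Cu_proj U e)) -> f =1 f'.
Proof.
have [pP p0 pM] := Cu_family U.
have famf : projection_family (fun e => f (Cu_proj U e)).
  split=> [e||d e].
  - have [pe ppe] := pP e.
    by split; [rewrite -starhom_star pe | rewrite -gmulfM ppe].
  - by rewrite p0 raddf0.
  - by rewrite pM gmulfM.
have [h [_ hu]] := Cu_universal U famf.
by move=> ff' x; rewrite (hu f)// (hu f').
Qed.

Lemma starhom_eq0 (f : {starhom U -> B}) :
  (forall e, f (Cu_proj U e) = 0) -> forall x, f x = 0.
Proof.
move=> f0 x; apply/eqP; rewrite -normr_le0; apply/ler_addgt0Pr => e e0.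
have [z Dz xz] := proj_span_dense x e0.
have fz : f z = 0.
  elim: Dz => [|a _ y [d _ <-] _ fy]; first by rewrite raddf0.
  by rewrite linearD linearZ /= f0 fy scaler0 addr0.
rewrite add0r; apply: le_trans (ltW xz); apply: le_trans (starhom_norm f _).
by rewrite raddfB /= fz subr0.
Qed.
End StarHomsOnUniversal.

(** The kernel of [f] is the closure of the span of the integral idempotents
    in it, and [h] reaches these. *)
Lemma starhom_kernel_range (R : realType) (E E' : semilatticeType)
    (U : universal_cstar R E) (U' : universal_cstar R E') (B : cstarType R)
    (f : {starhom U -> B}) (h : {starhom U' -> U}) :
  (forall r, f (Cu_span U r) = 0 -> exists q, h (Cu_span U' q) = Cu_span U r) ->
  forall x, f x = 0 -> exists y, h y = x.
Proof.
move=> fh x fx; apply: starhom_range_closed => e e0.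
have e20 : 0 < e / 2 by rewrite divr_gt0.
have [z Dz xz] := proj_span_dense x e20.
have [y kery zy] := proj_span_trim f Dz.
have [w Dw hw] : exists2 w : U', proj_span w & h w = y.
  elim: kery => [|a _ y' [r fr <-] _ [w Dw <-]].
    by exists 0; [exact: lspan0 | rewrite raddf0].
  have [q hq] := fh r fr; exists (a *: Cu_span U' q + w).
    by apply/lspanD => //; apply/lspanZ/proj_span_Cu_span.
  by rewrite linearD linearZ /= hq.
exists w => //; rewrite hw (splitr e) -(subrKA z).
apply: le_lt_trans (ler_normD _ _) _; apply: ltr_leD => //.
apply: le_trans zy _; apply: le_trans (ltW xz).
apply: le_trans (starhom_norm f _).
by rewrite raddfB /= fx sub0r normrN.
Qed.

Section InducedMaps.
Variable R : realType.

Lemma Cu_map_span (E' E : semilatticeType) (U' : universal_cstar R E')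
    (U : universal_cstar R E) (phi : {rng Z0 E' -> Z0 E}) x :
  Cu_map U' U phi (Cu_span U' x) = Cu_span U (phi x).
Proof.
elim/Z0_gen_ind: x => [e|x y IHx IHy|].
- by rewrite Cu_spanE Cu_liftE.
- by rewrite !raddfB /= IHx IHy.
- by rewrite !raddf0.
Qed.

Lemma Cu_map_C0_span (E : semilatticeType) (U : universal_cstar R E)
    (T : topologicalType) (eps : {rng Z0 E -> C0Z T}) x :
  Cu_map_C0 U eps (Cu_span U x) = C0Z_C0 R (eps x).
Proof.
elim/Z0_gen_ind: x => [e|x y IHx IHy|].
- by rewrite Cu_spanE Cu_liftE.
- by rewrite !raddfB /= IHx IHy; apply: C0_eq => t; rewrite /= rmorphB.
- by rewrite !raddf0; exact: C0_eq.
Qed.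

Lemma C0Z_C0_eq0 (T : topologicalType) (h : C0Z T) : C0Z_C0 R h = 0 -> h = 0.
Proof.
move=> h0; apply: C0Z_eq => x; apply/eqP; rewrite -(intr_eq0 R[i]).
by rewrite -[X in X == _]/(C0Z_C0 R h x) h0.
Qed.

Variable G : groupType.

Lemma Z0_act_z0 (E : gsemilattice G) g e : Z0_act g (z0 e) = z0 (gsl_act g e) :> Z0 E.
Proof. by rewrite /Z0_act Z0_liftE// gsl_act0 z00. Qed.

Lemma Cu_act_span (E : gsemilattice G) (U : universal_cstar R E) g x :
  Cu_act U g (Cu_span U x) = Cu_span U (Z0_act g x).
Proof.
have act0 : z0 (gsl_act g slzero) = 0 :> Z0 E by rewrite gsl_act0 z00.
elim/Z0_gen_ind: x => [e|x y IHx IHy|].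
- by rewrite Cu_spanE Cu_liftE Z0_act_z0 Cu_spanE.
- by rewrite /Z0_act (Z0_liftB act0) !raddfB /= IHx IHy.
- have -> : Z0_act g 0 = 0 :> Z0 E.
    by rewrite -[X in Z0_act g X](subrr 0) /Z0_act (Z0_liftB act0) subrr.
  by rewrite !raddf0.
Qed.
End InducedMaps.

(* E 0 is the semilattice E of the paper, E k is E_k for k >= 1, and the
   complex numbers are R[i]. *)
Theorem corollary3p2 (R : realType) (Gamma : groupType)
    (Gamma_countable : countable [set: Gamma])
    (Omega : td_system Gamma) (E : nat -> gsemilattice Gamma)
    (eps : {rng Z0 (E 0%N) -> C0Z Omega})
    (phi : forall k : nat, {rng Z0 (E k.+1) -> Z0 (E k)})
    (Cu : forall k : nat, universal_cstar R (E k)) :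
  algebraic_independent_resolution eps phi ->
  independent_resolution (Cu_map_C0 (Cu 0%N) eps)
    (fun k : nat => Cu_map (Cu k.+1) (Cu k) (phi k)).
Proof.
move=> [eps_act phi_act [eps_surj eps_exact phi_exact]]; split.
- move=> g; apply: (@starhom_eq _ _ _ _
    (Cu_map_C0 (Cu 0%N) eps \o Cu_act (Cu 0%N) g) (C0_act g \o Cu_map_C0 (Cu 0%N) eps)).
  move=> e; rewrite /= !Cu_liftE -Z0_act_z0 eps_act; exact: C0_eq.
- move=> k g; apply: (@starhom_eq _ _ _ _
    (Cu_map (Cu k.+1) (Cu k) (phi k) \o Cu_act (Cu k.+1) g)
    (Cu_act (Cu k) g \o Cu_map (Cu k.+1) (Cu k) (phi k))).
  by move=> e; rewrite /= !Cu_liftE -Z0_act_z0 phi_act Cu_act_span.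
split=> [y|x|k x].
- apply: starhom_range_closed => e e0.
  have [f Sf yf] := locally_constant_dense (@td_hausdorff _ Omega)
    (@td_locally_compact _ Omega) (@td_totally_disconnected _ Omega) y e0.
  suff [w Dw wf] : exists2 w : Cu 0%N, proj_span w & Cu_map_C0 (Cu 0%N) eps w = f.
    by exists w => //; rewrite wf.
  elim: Sf => [|a _ f' [h _ <-] _ [w Dw <-]].
    by exists 0; [exact: lspan0 | rewrite raddf0].
  have [r rh] := eps_surj h; exists (a *: Cu_span (Cu 0%N) r + w).
    by apply/lspanD => //; apply/lspanZ/proj_span_Cu_span.
  by rewrite linearD linearZ /= Cu_map_C0_span rh.
- split=> [|[y <-]].
    apply: starhom_kernel_range => r.
    rewrite Cu_map_C0_span => /C0Z_C0_eq0/eps_exact[q qr].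
    by exists q; rewrite Cu_map_span qr.
  apply: (@starhom_eq0 _ _ _ _
    (Cu_map_C0 (Cu 0%N) eps \o Cu_map (Cu 1%N) (Cu 0%N) (phi 0%N))) => e.
  rewrite /= Cu_liftE Cu_map_C0_span.
  have -> : eps (phi 0%N (z0 e)) = 0 by apply/eps_exact; exists (z0 e).
  exact: C0_eq.
- split=> [|[y <-]].
    apply: starhom_kernel_range => r.
    rewrite Cu_map_span -[X in _ = X](raddf0 (Cu_span (Cu k))).
    move=> /Cu_span_inj/phi_exact[q qr].
    by exists q; rewrite Cu_map_span qr.
  apply: (@starhom_eq0 _ _ _ _
    (Cu_map (Cu k.+1) (Cu k) (phi k) \o Cu_map (Cu k.+2) (Cu k.+1) (phi k.+1))) => e.
  rewrite /= Cu_liftE Cu_map_span.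
  have -> : phi k (phi k.+1 (z0 e)) = 0 by apply/phi_exact; exists (z0 e).
  by rewrite raddf0.
Qed.
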